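(* There are only countably many non-Haar null conjugacy classes in $\mathrm{Homeo}^+(\mathbb{S}^1)$.
   Context: $\mathbb{S}^1=\mathbb{R}/\mathbb{Z}$, and $\mathrm{Homeo}^+(\mathbb{S}^1)$ is the Polish group (under composition) of orientation preserving homeomorphisms of $\mathbb{S}^1$ with the uniform topology. Haar null sets (Christensen): in a Polish group $G$, a Borel set $B\subset G$ is Haar null if there is a Borel probability measure $\mu$ on $G$ such that $\mu(gBh)=0$ for all $g,h\in G$; an arbitrary set $S \subset G$ is Haar null if it is contained in a Borel Haar null set; a set is non-Haar null if it is not Haar null. *)

(* Defs.v *)
From HB Require Import structures.
From mathcomp Require Import all_boot all_order all_algebra.
From mathcomp Require Import archimedean ring_quotient generic_quotient.
From mathcomp Require Import ring lra.
From mathcomp Require Import all_classical all_reals all_analysis.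

Set Implicit Arguments.
Unset Strict Implicit.
Unset Printing Implicit Defensive.

Import Order.TTheory GRing.Theory Num.Theory.
Import numFieldNormedType.Exports.

Local Open Scope classical_set_scope.
Local Open Scope ring_scope.
Local Open Scope quotient_scope.

HB.mixin Record isTopologicalGroup G of Group G & PointedTopological G := {
  mulg_continuous : continuous (fun xy : G * G => (xy.1 * xy.2)%g);
  invg_continuous : continuous (fun x : G => (x^-1)%g)
}.

(* Pointedness is only there because the measurable types of the library are
   pointed. *)
#[short(type="topologicalGroupType")]
HB.structure Definition TopologicalGroup :=
  {G of Group G & PointedTopological G & isTopologicalGroup G}.

(* Christensen's definition.  It is used for Polish groups but makes sense in
   any topological group, so Polishness is not bundled here.  Translates of
   Borel sets are Borel because left and right translations are
   homeomorphisms. *)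
Section haar_null.
Context {G : topologicalGroupType}.

Definition borel : set (set G) := <<s open >>.

Definition translate (g : G) (B : set G) (h : G) : set G :=
  [set (g * b * h)%g | b in B].

Definition borel_haar_null (R : realType) (B : set G) :=
  borel B /\
  exists mu : probability (g_sigma_algebraType (@open G)) R,
    forall g h : G, mu (translate g B h) = 0%E.

Definition haar_null (R : realType) (S : set G) :=
  exists2 B : set G, S `<=` B & borel_haar_null R B.

Definition conjugacy_class (f : G) : set G := [set (f ^ h)%g | h in setT].

End haar_null.

Section circle.
Context (R : realType).

Definition Zsub : zmodClosed R :=
  GRing.ZmodClosed.clone R (@Num.int_num_subdef R) _.

Definition circle : Type := Quotient.quot Zsub.

HB.instance Definition _ := Choice.on circle.
HB.instance Definition _ := GRing.Zmodule.on circle.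
HB.instance Definition _ := Quotient.on circle.
HB.instance Definition _ := EqQuotient.on circle.

Definition circle_pi (a : R) : circle := \pi_circle a.

Lemma circle_piE a b : (circle_pi a = circle_pi b) <-> (a - b \is a Num.int).
Proof.
split=> [/eqP|h]; first by rewrite /circle_pi -Quotient.idealrBE.
by apply/eqP; rewrite /circle_pi -Quotient.idealrBE.
Qed.

Lemma circle_reprK : cancel (repr : circle -> R) circle_pi.
Proof. exact: reprK. Qed.

Definition circle_dist (x y : circle) : R :=
  inf [set `|a - b| | a in circle_pi @^-1` [set x]
                    & b in circle_pi @^-1` [set y]].

Let D (x y : circle) : set R :=
  [set `|a - b| | a in circle_pi @^-1` [set x]
                & b in circle_pi @^-1` [set y]].

Let D0 x y : D x y !=set0.
Proof.
exists `|repr x - repr y|; exists (repr x); first exact: circle_reprK.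
by exists (repr y) => //; exact: circle_reprK.
Qed.

Let Dlb x y : lbound (D x y) 0.
Proof. by move=> _ [a _ [b _ <-]]. Qed.

Let Dinf x y : has_inf (D x y).
Proof. by split; [exact: D0|exists 0; exact: Dlb]. Qed.

Lemma circle_dist_lt x y e : circle_dist x y < e <->
  exists a b, [/\ circle_pi a = x, circle_pi b = y & `|a - b| < e].
Proof.
split=> [xye|[a [b [<- <- abe]]]].
  have e0 : 0 < e - circle_dist x y by rewrite subr_gt0.
  have [_ [a ax [b bx <-]]] := inf_adherent e0 (Dinf x y).
  by rewrite -/(circle_dist x y) subrKC => abe; exists a, b.
apply: le_lt_trans abe; apply: ge_inf; first by exists 0; exact: Dlb.
by exists a => //; exists b.
Qed.

Let dist_ge0 x y : 0 <= circle_dist x y.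
Proof. exact: lb_le_inf (D0 x y) (@Dlb x y). Qed.

Lemma circle_distxx x : circle_dist x x = 0.
Proof.
apply/eqP; rewrite eq_le dist_ge0 andbT; apply/ler_addgt0Pl => e e0.
rewrite addr0; apply/ltW/circle_dist_lt.
by exists (repr x), (repr x); rewrite circle_reprK subrr normr0.
Qed.

Lemma circle_dist_sym x y : circle_dist x y = circle_dist y x.
Proof.
congr inf; apply/seteqP; split=> _ [a ax [b bx <-]];
  by exists b => //; exists a => //; rewrite distrC.
Qed.

Lemma circle_dist_triangle y x z :
  circle_dist x z <= circle_dist x y + circle_dist y z.
Proof.
apply/ler_addgt0Pl => e e0; apply/ltW/circle_dist_lt => //.
have e20 : 0 < e / 2 by rewrite divr_gt0.
have /circle_dist_lt[a [b [ax bx ab]]] : circle_dist x y < circle_dist x y + e / 2.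
  by rewrite ltrDl.
have /circle_dist_lt[c [d [cy dz cd]]] : circle_dist y z < circle_dist y z + e / 2.
  by rewrite ltrDl.

exists a, (d + (b - c)); split=> //.
  rewrite -dz; apply/circle_piE; rewrite addrAC subrr add0r.
  by apply/circle_piE; rewrite bx cy.
rewrite (_ : a - (d + (b - c)) = (a - b) + (c - d)); last by ring.
rewrite (le_lt_trans (ler_normD _ _))//; move: ab cd; lra.
Qed.

Lemma circle_dist_positivity x y : circle_dist x y = 0 -> x = y.
Proof.
move=> xy0; have half0 : 0 < 2^-1 :> R by rewrite invr_gt0.
have /circle_dist_lt[a [b [ax bx ab]]] : circle_dist x y < 2^-1 by rewrite xy0.
have [ab0|ab0] := eqVneq (a - b) 0.
  by rewrite -ax -bx; congr circle_pi; apply/eqP; rewrite -subr_eq0 ab0.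
have /circle_dist_lt[c [d [cx dx]]] : circle_dist x y < Num.min 2^-1 `|a - b|.
  by rewrite xy0 lt_min half0 normr_gt0.
rewrite lt_min => /andP[cd cdab].
have : (c - d) - (a - b) \is a Num.int.
  rewrite (_ : _ - _ = (c - a) - (d - b)); last by ring.
  by apply: rpredB; apply/circle_piE; rewrite ?cx ?dx.
have [/eqP|w0 wZ] := eqVneq ((c - d) - (a - b)) 0.
  by rewrite subr_eq0 => /eqP cdE; rewrite cdE ltxx in cdab.
have := norm_intr_ge1 wZ w0; rewrite leNgt => /negP[].
by rewrite (le_lt_trans (ler_normB _ _))// [ltRHS]splitr !mul1r ltrD.
Qed.

HB.instance Definition _ := isMetric.Build R circle circle_distxx
  circle_dist_positivity circle_dist_sym circle_dist_triangle.

HB.instance Definition _ := isPointed.Build circle (circle_pi 0).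

Lemma circle_pi_continuous : continuous circle_pi.
Proof.
move=> a; apply/cvg_ballP => e e0; near=> b; rewrite ballEmdist/=.
apply/circle_dist_lt; exists a, b; split => //; near: b.
Unshelve. all: by end_near. Qed.

(* The metric induces the quotient topology of the real line. *)
Lemma circle_openE (U : set circle) : open U <-> open (circle_pi @^-1` U).
Proof.
split=> oU.
  by apply: (continuousP circle_pi).1 oU; exact: circle_pi_continuous.
rewrite openE => x Ux; have oUx : (circle_pi @^-1` U) (repr x).
  by rewrite /= circle_reprK.
have [e /= e0 eU] : nbhs_ball (repr x) (circle_pi @^-1` U).
  by apply/nbhs_ballP; exact: open_nbhs_nbhs.
apply/nbhs_ballP; exists e => //= y; rewrite ballEmdist/= => /circle_dist_lt.
move=> [a [b [ax yb ab]]].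
have <- : circle_pi (b - (a - repr x)) = y.
  rewrite -yb; apply/circle_piE; rewrite addrAC subrr add0r rpredN.
  by apply/circle_piE; rewrite ax circle_reprK.
apply: eU; rewrite /ball/= (_ : _ - _ = a - b)//; by ring.
Qed.

Lemma circle_compact : compact [set: circle].
Proof.
have <- : circle_pi @` `[0, 1]%classic = [set: circle].
  apply/seteqP; split=> // x _; exists (repr x - (Num.floor (repr x))%:~R).
    rewrite /= in_itv/= subr_ge0 floor_le_tmp/=.
    by have := lt_succ_floor (repr x); rewrite intrD; lra.
  rewrite -[RHS]circle_reprK; apply/circle_piE.
  by rewrite addrAC subrr add0r rpredN intr_int.
apply: continuous_compact; last exact: segment_compact.
exact/continuous_subspaceT/circle_pi_continuous.
Qed.

End circle.

Section homeoS1.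
Context (R : realType).
Local Notation S1 := (circle R).

Definition homeomorphism (f : S1 -> S1) :=
  exists g : S1 -> S1,
    [/\ cancel f g, cancel g f, continuous f & continuous g].

(* F is a continuous increasing lift of f to the universal cover. *)
Definition orientation_preserving (f : S1 -> S1) :=
  exists F : R -> R, [/\ continuous F, {homo F : a b / a < b} &
    forall a, circle_pi (F a) = f (circle_pi a)].

(* The subspace topology of the topology of uniform convergence. *)
Definition homeoS1 : Type :=
  set_type [set f : {uniform S1 -> S1} |
    homeomorphism f /\ orientation_preserving f].

HB.instance Definition _ := Uniform.on homeoS1.
HB.instance Definition _ := SubType.on homeoS1.

Definition fun_of_homeoS1 (f : homeoS1) : S1 -> S1 := \val f.
Local Coercion fun_of_homeoS1 : homeoS1 >-> Funclass.

Lemma homeoS1P (f : homeoS1) : homeomorphism f /\ orientation_preserving f.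
Proof. by have := set_mem (valP f). Qed.

Lemma homeoS1_ext (f g : homeoS1) : f =1 g -> f = g.
Proof. by move=> fg; apply/val_inj/funext. Qed.

Definition mk_homeoS1 (f : S1 -> S1) (fP : homeomorphism f)
    (fo : orientation_preserving f) : homeoS1 :=
  exist _ (f : {uniform S1 -> S1}) (mem_set (conj fP fo)).

Lemma homeomorphism_id : homeomorphism id.
Proof. by exists id; split=> //; move=> x; exact: cvg_id. Qed.

Lemma orientation_preserving_id : orientation_preserving id.
Proof. by exists id; split=> //; move=> x; exact: cvg_id. Qed.

Lemma homeomorphism_comp f g :
  homeomorphism f -> homeomorphism g -> homeomorphism (f \o g).
Proof.
move=> [f' [fK f'K cf cf']] [g' [gK g'K cg cg']]; exists (g' \o f'); split.
- exact: can_comp.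
- exact: can_comp.
- by move=> x; apply: continuous_comp; [exact: cg|exact: cf].
- by move=> x; apply: continuous_comp; [exact: cf'|exact: cg'].
Qed.

Lemma orientation_preserving_comp f g :
  orientation_preserving f -> orientation_preserving g ->
  orientation_preserving (f \o g).
Proof.
move=> [F [cF iF FE]] [G [cG iG GE]]; exists (F \o G); split.
- by move=> x; apply: continuous_comp; [exact: cG|exact: cF].
- by move=> a b ab; apply/iF/iG.
- by move=> a /=; rewrite FE GE.
Qed.

Lemma homeomorphism_can f g : homeomorphism f -> cancel f g -> homeomorphism g.
Proof.
move=> [f' [fK f'K cf cf']] gK.
have -> : g = f' by apply/funext => x; rewrite -[x in LHS]f'K gK.
by exists f.
Qed.

Lemma orientation_preserving_can f g : cancel f g -> cancel g f ->
  orientation_preserving f -> orientation_preserving g.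
Proof.
move=> fK gK [F [cF iF FE]].
have mF : {mono F : a b / a <= b} by exact: le_mono.
have F1 a : F a + 1 <= F (a + 1).
  have aa1 : F a < F (a + 1) by rewrite iF// ltrDl.
  have : F (a + 1) - F a \is a Num.int.
    apply/circle_piE; rewrite !FE; congr f; apply/circle_piE.
    by rewrite addrAC subrr add0r int_num1.
  move=> /norm_intr_ge1; rewrite subr_eq0 gt_eqF// => /(_ isT).
  by rewrite gtr0_norm ?subr_gt0// lerBrDl.
have Fn a n : F a + n%:R <= F (a + n%:R).
  elim: n => [|n ih]; first by rewrite !addr0.
  rewrite -natr1 !addrA; apply: le_trans (F1 _); exact: lerD.
have Fs v : exists a, F a = v.
  pose n := Num.bound `|v - F 0|.
  have vn : `|v - F 0| <= n%:R.
    by rewrite ltW//; exact: archi_boundP.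
  have le1 : F (- n%:R) <= v.
    have := Fn (- n%:R) n; rewrite addNr => h.
    move: vn; rewrite ler_norml => /andP[+ _]; lra.
  have le2 : v <= F n%:R.
    have := Fn 0 n; rewrite add0r => h.
    move: vn; rewrite ler_norml => /andP[_ +]; lra.
  have nn : - n%:R <= n%:R :> R by rewrite -subr_ge0 opprK addr_ge0.
  have [||a _ <-] := @IVT R F _ _ v nn; last by exists a.
    exact: continuous_subspaceT.
  by rewrite ge_min le1/= le_max le2 orbT.
pose H v := sval (cid (Fs v)).
have HK : cancel H F by move=> v; rewrite /H; case: cid.
have FK : cancel F H by apply: inj_can_sym HK _; exact: inc_inj.
exists H; split.
- move=> v; rewrite -(HK v).
  have nK : {near H v, cancel F H} by near=> w; exact: FK.
  have nF : {near H v, continuous F} by near=> w; exact: cF.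
  exact: nbhs_singleton (near_can_continuous nK nF).
- by move=> v w vw; rewrite -(leW_mono mF) !HK.
- by move=> v; rewrite -{2}(HK v) FE fK.
Unshelve. all: by end_near. Qed.

Definition homeoS1_one : homeoS1 :=
  mk_homeoS1 homeomorphism_id orientation_preserving_id.

Definition homeoS1_mul (f g : homeoS1) : homeoS1 :=
  mk_homeoS1 (homeomorphism_comp (homeoS1P f).1 (homeoS1P g).1)
    (orientation_preserving_comp (homeoS1P f).2 (homeoS1P g).2).

Definition homeoS1_invfun (f : homeoS1) : S1 -> S1 :=
  sval (cid (homeoS1P f).1).

Lemma homeoS1_invfunK (f : homeoS1) : cancel f (homeoS1_invfun f).
Proof. by rewrite /homeoS1_invfun; case: cid => g /= []. Qed.

Lemma homeoS1_invfunKV (f : homeoS1) : cancel (homeoS1_invfun f) f.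
Proof. by rewrite /homeoS1_invfun; case: cid => g /= []. Qed.

Definition homeoS1_inv (f : homeoS1) : homeoS1 :=
  mk_homeoS1 (homeomorphism_can (homeoS1P f).1 (homeoS1_invfunK f))
    (orientation_preserving_can (homeoS1_invfunK f) (homeoS1_invfunKV f)
      (homeoS1P f).2).

Let mulA : associative homeoS1_mul.
Proof. by move=> f g h; apply: homeoS1_ext. Qed.

Let mul1 : left_id homeoS1_one homeoS1_mul.
Proof. by move=> f; apply: homeoS1_ext. Qed.

Let mulr1 : right_id homeoS1_one homeoS1_mul.
Proof. by move=> f; apply: homeoS1_ext. Qed.

Let mulV : left_inverse homeoS1_one homeoS1_inv homeoS1_mul.
Proof. by move=> f; apply: homeoS1_ext => x; exact: homeoS1_invfunK. Qed.

Let mulrV : right_inverse homeoS1_one homeoS1_inv homeoS1_mul.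
Proof. by move=> f; apply: homeoS1_ext => x; exact: homeoS1_invfunKV. Qed.

HB.instance Definition _ :=
  isGroup.Build homeoS1 mulA mul1 mulr1 mulV mulrV.

HB.instance Definition _ := isPointed.Build homeoS1 homeoS1_one.

Lemma nbhs_homeoS1P (f : homeoS1) (A : set homeoS1) : nbhs f A <->
  exists2 e : R, 0 < e &
    [set g : homeoS1 | forall x, circle_dist (f x) (g x) < e] `<=` A.
Proof.
split.
- move=> [_ [[V oV <-] Vf] VA].
  have /uniform_nbhs[E [+ EV]] : nbhs (\val f : {uniform S1 -> S1}) V.
    exact: open_nbhs_nbhs.
  rewrite -entourage_ballE => -[e /= e0 eE]; exists e => // g fg.
  apply: VA; apply: EV => x _; apply: eE; rewrite /= ballEmdist.
  by move: fg => /(_ x).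
- move=> [e e0 eA].
  apply: (filterS eA).
  pose V : set {uniform S1 -> S1} := [set g | forall x, ball (f x) e (g x)].
  have fV : nbhs (\val f : {uniform S1 -> S1}) V.
    apply/uniform_nbhs; exists [set xy | ball xy.1 e xy.2]; split.
      by rewrite -entourage_ballE; exists e.
    by move=> g /= fg x; exact: fg.
  have fVv : nbhs f ((\val : homeoS1 -> {uniform S1 -> S1}) @^-1` V).
    exact: (@initial_continuous _ {uniform S1 -> S1}
      (\val : homeoS1 -> {uniform S1 -> S1}) f V fV).
  apply: filterS fVv => g fg x; have := fg x.
  by rewrite ballEmdist.
Qed.

Lemma homeoS1_unif_continuous (f : homeoS1) (e : R) : 0 < e ->
  exists2 d : R, 0 < d &
    forall x y, circle_dist x y < d -> circle_dist (f x) (f y) < e.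
Proof.
move=> e0; have [[g [_ _ cf _]] _] := homeoS1P f.
pose P (d : R) x := forall y, circle_dist x y < d ->
  circle_dist (f x) (f y) < e.
have e20 : 0 < e / 2 by rewrite divr_gt0.
have : \forall d \near 0^'+, [set: S1] `<=` P d.
  apply: (compact_near_coveringP _).1 => [|x _]; first exact: circle_compact.
  have /cvg_ballP/(_ _ e20)/nbhs_ballP[d /= d0 df] := cf x.
  have d20 : 0 < d / 2 by rewrite divr_gt0.
  exists (ball x (d / 2), [set t | t < d / 2]) => /=.
    by split; [exact: nbhsx_ballx|exact: nbhs_right_lt].
  move=> [x' t] /= [xx' td] y x'y.
  have fx' : circle_dist (f x) (f x') < e / 2.
    have := df x'; rewrite !ballEmdist/=; apply; apply: lt_trans (_ : d / 2 < d).
      by move: xx'; rewrite ballEmdist.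
    by rewrite ltr_pdivrMr// ltr_pMr// ltr1n.
  have fy : circle_dist (f x) (f y) < e / 2.
    have := df y; rewrite !ballEmdist/=; apply.
    rewrite (le_lt_trans (circle_dist_triangle x' _ _))// [ltRHS]splitr.
    by rewrite ltrD// ?(lt_trans x'y)//; move: xx'; rewrite ballEmdist.
  rewrite (le_lt_trans (circle_dist_triangle (f x) _ _))// [ltRHS]splitr ltrD//.
  by rewrite circle_dist_sym.
move=> hP; have : \forall d \near 0^'+, 0 < d /\ [set: S1] `<=` P d.
  by apply: filterI => //; exact: nbhs_right_gt.
by move=> /filter_ex[d [d0 dP]]; exists d => // x y; exact: dP.
Qed.

Let mul_continuous :
  continuous (fun fg : homeoS1 * homeoS1 => (fg.1 * fg.2)%g).
Proof.
move=> [f0 g0] A.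
have [f ->] : exists f : homeoS1, f0 = f by exists f0.
have [g ->] : exists g : homeoS1, g0 = g by exists g0.
move=> /nbhs_homeoS1P[e e0 eA].
have e20 : 0 < e / 2 by rewrite divr_gt0.
have [d d0 df] := homeoS1_unif_continuous f e20.
have key (f' g' : homeoS1) : (forall x, circle_dist (f x) (f' x) < e / 2) ->
    (forall x, circle_dist (g x) (g' x) < d) -> A (f' * g')%g.
  move=> ff' gg'; apply: eA => x /=.
  rewrite (le_lt_trans (circle_dist_triangle (f (g' x)) _ _))//.
  by rewrite [ltRHS]splitr ltrD//; apply: df; exact: gg'.
exists ([set f' : homeoS1 | forall x, circle_dist (f x) (f' x) < e / 2],
        [set g' : homeoS1 | forall x, circle_dist (g x) (g' x) < d]).
  by split; apply/nbhs_homeoS1P; [exists (e / 2)|exists d].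
by move=> [f' g'] [] /=; exact: key.
Qed.

Let inv_continuous : continuous (fun f : homeoS1 => (f^-1)%g).
Proof.
move=> f0 A; have [f ->] : exists f : homeoS1, f0 = f by exists f0.
move=> /nbhs_homeoS1P[e e0 eA].
have [d d0 df] := homeoS1_unif_continuous (f^-1)%g e0.
apply/nbhs_homeoS1P; exists d => // g fg; apply: eA => y /=.
pose x := homeoS1_invfun g y.
have -> : fun_of_homeoS1 (g^-1)%g y = fun_of_homeoS1 (f^-1)%g (f x).
  by rewrite /= -/x; apply/esym/homeoS1_invfunK.
rewrite circle_dist_sym; apply: df; have := fg x.
by rewrite homeoS1_invfunKV.
Qed.

HB.instance Definition _ :=
  isTopologicalGroup.Build homeoS1 mul_continuous inv_continuous.

End homeoS1.

(* Main.v *)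
(* Write F : R -> R for a lift of f. Everything rests on the family F + t, t in
   R, which lifts the translates of f by rotations; the law of a uniformly
   distributed rotation witnesses Haar nullity.
   - If f has no periodic point, F^k comes arbitrarily close to an integer
     translation at some point, so moving t changes the position of the rotation
     number relative to some rational. Hence F + t has a given irrational
     rotation number for at most one t, and the class of f is Haar null.
   - The points x with (F + t)^q x = x + p are the solutions of tau x = t, where
     tau x - x is nonincreasing. So tau has bounded variation and almost all its
     level sets are finite in bounded intervals: if f^q has infinitely many fixed
     points, then the class of f is Haar null.
   - Otherwise f has finitely many periodic points, at least one. Its class is
     then determined by the rotation number and the directions in which
     F^q - p moves the points of the gaps between consecutive fixed points. *)

From HB Require Import structures.
Require Import Defs.
From mathcomp Require Import all_boot all_order all_algebra.
From mathcomp Require Import zify ring lra.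
From mathcomp Require Import all_classical all_reals all_analysis.
From mathcomp Require Import measurable_realfun.

Set Implicit Arguments.
Unset Strict Implicit.
Unset Printing Implicit Defensive.

Import Order.TTheory GRing.Theory Num.Theory.
Import numFieldNormedType.Exports.

Local Open Scope classical_set_scope.
Local Open Scope ring_scope.

(** * Lifts *)

Section lifts.
Context {R : realType}.
Local Notation S1 := (circle R).
Local Notation G := (homeoS1 R).
Implicit Types (F H K : R -> R) (f g : G).

(** By [lift_exists] and [homeo_of_degree1], such maps represent exactly the orientation preserving
    homeomorphisms of the circle. *)
Definition degree1 F := [/\ continuous F, {homo F : a b / a < b} &
  forall x, F (x + 1) = F x + 1].

Definition lift_of f F :=
  degree1 F /\ forall a, circle_pi (F a) = fun_of_homeoS1 f (circle_pi a).

Lemma circle_piDint (a b : R) : b \is a Num.int ->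
  circle_pi (a + b) = circle_pi a.
Proof. by move=> bZ; apply/circle_piE; rewrite addrAC subrr add0r. Qed.

Lemma degree1_mono F : degree1 F -> {mono F : a b / a < b}.
Proof. by case=> _ h _; exact: leW_mono (le_mono h). Qed.

Lemma degree1_le F : degree1 F -> {mono F : a b / a <= b}.
Proof. by case=> _ h _; exact: le_mono. Qed.

Lemma degree1_inj F : degree1 F -> injective F.
Proof. by move=> /degree1_le/inc_inj. Qed.

Lemma degree1_nat F : degree1 F -> forall x n, F (x + n%:R) = F x + n%:R.
Proof.
move=> [_ _ F1] x; elim=> [|n ih]; first by rewrite !addr0.
by rewrite -natr1 !addrA F1 ih.
Qed.

Lemma degree1_int F : degree1 F -> forall x (n : int),
  F (x + n%:~R) = F x + n%:~R.
Proof.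
move=> dF x [] n; first exact: degree1_nat.
rewrite NegzE mulrNz -[in RHS](subrK (n.+1%:~R) x) degree1_nat//.
by rewrite addrK.
Qed.

Lemma degree1_id : degree1 id.
Proof. by split => //; move=> x; exact: cvg_id. Qed.

Lemma degree1_comp F H : degree1 F -> degree1 H -> degree1 (F \o H).
Proof.
move=> [cF iF F1] [cH iH H1]; split.
- by move=> x; apply: continuous_comp; [exact: cH|exact: cF].
- by move=> a b ab; apply/iF/iH.
- by move=> x /=; rewrite H1 F1.
Qed.

Lemma degree1_add F t : degree1 F -> degree1 (fun x => F x + t).
Proof.
move=> [cF iF F1]; split.
- by move=> x; apply: cvgD; [exact: cF|exact: cvg_cst].
- by move=> a b /iF; rewrite ltrD2r.
- by move=> x; rewrite F1 addrAC.
Qed.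

Lemma degree1_iter F n : degree1 F -> degree1 (iter n F).
Proof.
move=> dF; elim: n => [|n ih]; first exact: degree1_id.
exact: degree1_comp dF ih.
Qed.

Lemma degree1_surj F : degree1 F -> forall v, exists a, F a = v.
Proof.
move=> dF v; have [cF _ _] := dF.
pose n := Num.bound `|v - F 0|.
have vn : `|v - F 0| <= n%:R by rewrite ltW//; exact: archi_boundP.
have nn : - n%:R <= n%:R :> R by rewrite -subr_ge0 opprK addr_ge0.
have Fn : F n%:R = F 0 + n%:R by rewrite -degree1_nat// add0r.
have FNn : F (- n%:R) = F 0 - n%:R.
  by rewrite -[in RHS](addNr n%:R) degree1_nat// addrK.
have [||a _ <-] := @IVT R F _ _ v nn; last by exists a.
  exact: continuous_subspaceT.
move: vn; rewrite ler_norml => /andP[v1 v2].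
by rewrite Fn FNn ge_min le_max; apply/andP; split; apply/orP; [left|right]; lra.
Qed.

Lemma increasing_can_continuous F H : {homo F : a b / a < b} ->
  cancel F H -> cancel H F -> continuous H.
Proof.
move=> iF FK HK v; have mF : {mono F : a b / a < b} := leW_mono (le_mono iF).
have iH : {homo H : a b / a < b} by move=> a b; rewrite -(mF (H a)) !HK.
apply/cvgrPdist_lt => e e0; near=> w.
have : F (H v - e) < w by near: w; apply: lt_nbhsr; rewrite -{2}(HK v) mF ltrBlDr ltrDl.
have : w < F (H v + e) by near: w; apply: lt_nbhsl; rewrite -{1}(HK v) mF ltrDl.
by move=> /iH + /iH; rewrite !FK ltr_norml => h1 h2; apply/andP; split; lra.
Unshelve. all: by end_near. Qed.

Lemma degree1_inv F : degree1 F -> exists2 H, degree1 H &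
  cancel F H /\ cancel H F.
Proof.
move=> dF; have [cF iF F1] := dF.
have /choice[H HK] := degree1_surj dF.
have FK : cancel F H by apply: inj_can_sym HK _; exact: degree1_inj.
exists H => //; split.
- exact: increasing_can_continuous iF FK HK.
- by move=> a b ab; rewrite -(degree1_mono dF) !HK.
- by move=> x; apply: (degree1_inj dF); rewrite F1 !HK.
Qed.

(** The definition of [orientation_preserving] does not mention unit translations. The increment
    [F (x + 1) - F x] is a positive integer; if it exceeded 1, the intermediate value theorem would
    give [y] strictly between [x] and [x + 1] with [F y = F x + 1], against injectivity of [f]. *)
Lemma lift_exists f : exists F, lift_of f F.
Proof.
have [[f' [fK _ _ _]] [F [cF iF FE]]] := homeoS1P f.
exists F; split => //; split => // x.
have FZ : F (x + 1) - F x \is a Num.int.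
  by apply/circle_piE; rewrite !FE circle_piDint ?int_num1.
have F0 : F x < F (x + 1) by rewrite iF// ltrDl.
apply/le_anti/andP; split; last first.
  have := norm_intr_ge1 FZ; rewrite subr_eq0 gt_eqF// => /(_ isT).
  by rewrite gtr0_norm ?subr_gt0// lerBrDl.
rewrite leNgt; apply/negP => F2.
have [|||y] := @IVT R F x (x + 1) (F x + 1).
- by rewrite lerDl.
- exact: continuous_subspaceT.
- by rewrite ge_min le_max lerDl ler01/= orbC; apply/orP; left; lra.
rewrite in_itv/= => /andP[xy yx] Fy.
have : y - x \is a Num.int.
  apply/circle_piE/(can_inj fK); rewrite -!FE Fy circle_piDint ?int_num1//.
have yx1 : y < x + 1.
  by rewrite lt_neqAle yx andbT; apply/eqP => yE; move: Fy F2; rewrite yE; lra.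
have xy1 : x < y.
  by rewrite lt_neqAle xy andbT; apply/eqP => yE; move: Fy; rewrite yE; lra.
move/norm_intr_ge1; rewrite subr_eq0 gt_eqF// => /(_ isT).
by rewrite gtr0_norm ?subr_gt0//; lra.
Qed.

Lemma lift_of_degree1 f F : lift_of f F -> degree1 F. Proof. by case. Qed.

Lemma lift_of_comp f g F H : lift_of f F -> lift_of g H ->
  lift_of (f * g)%g (F \o H).
Proof.
move=> [dF FE] [dH HE]; split; first exact: degree1_comp.
by move=> a /=; rewrite FE HE.
Qed.

Lemma lift_of_addint f F (n : int) : lift_of f F ->
  lift_of f (fun x => F x + n%:~R).
Proof.
move=> [dF FE]; split; first exact: degree1_add.
by move=> a; rewrite circle_piDint ?intr_int.
Qed.

Lemma lift_of_inv f F H : lift_of f F -> degree1 H -> cancel H F ->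
  lift_of (f^-1)%g H.
Proof.
move=> [dF FE] dH HK; split => // a.
rewrite -[in RHS](HK a) FE; exact/esym/homeoS1_invfunK.
Qed.

Lemma homeo_of_degree1 F : degree1 F -> exists f, lift_of f F.
Proof.
move=> dF; have [H dH [FK HK]] := degree1_inv dF.
(* [down K] evaluates [K] at a representative; degree 1 makes the result independent of it. *)
pose down (K : R -> R) (x : S1) := circle_pi (K (repr x)).
have downE K a : degree1 K -> down K (circle_pi a) = circle_pi (K a).
  move=> dK; rewrite /down.
  have /circle_piE/intrP[n /eqP] := circle_reprK (circle_pi a).
  by rewrite subr_eq addrC => /eqP ->; rewrite degree1_int// circle_piDint ?intr_int.
have downK K L : degree1 K -> degree1 L -> cancel K L -> cancel (down K) (down L).
  by move=> dK dL KL x; rewrite {2}/down downE// KL circle_reprK.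
have downC K : degree1 K -> continuous (down K).
  move=> dK; apply/continuousP => U oU; apply/circle_openE.
  have -> : @circle_pi R @^-1` (down K @^-1` U) = K @^-1` (@circle_pi R @^-1` U).
    by apply/funext => a /=; rewrite downE.
  by case: dK => cK _ _; move/continuousP: cK; apply; exact/circle_openE.
have hF : homeomorphism (down F) by exists (down H); split; auto.
have oF : orientation_preserving (down F).
  by case: (dF) => cF iF F1; exists F; split => // a; rewrite downE.
by exists (mk_homeoS1 hF oF); split => // a; rewrite -downE.
Qed.

(** Values of [D] are within 1/4 of integers, hence never half-integers, so by the intermediate
    value theorem the nearest integer cannot change. *)
Lemma degree1_close_int (D : R -> R) (e : R) : continuous D -> e <= 1 / 4 ->
  (forall x, exists n : int, `|D x - n%:~R| < e) ->
  exists n : int, forall x, `|D x - n%:~R| < e.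
Proof.
move=> cD e4 hD; have [n Dn] := hD 0; exists n => x.
have [m Dm] := hD x; have [->//|nm] := eqVneq n m; exfalso.
have nohalf z (k : int) : D z != k%:~R + 1 / 2.
  apply/eqP => Dz; have [l] := hD z; rewrite Dz => kl.
  have : `|((k - l) * 2 + 1)%:~R| < 1 :> R.
    rewrite intrD rmorphM/= rmorphB/=.
    rewrite (_ : _ + _ = 2 * (k%:~R + 1 / 2 - l%:~R)); last by field.
    by rewrite normrM ger0_norm//; lra.
  rewrite -intr_norm -[1]/(1%:~R) ltr_int; lia.
have [|||z _ Dz] := @IVT R D (Num.min 0 x) (Num.max 0 x) ((Num.min n m)%:~R + 1 / 2).
- by rewrite le_max ge_min lexx.
- exact: continuous_subspaceT.
- have : Num.min (D (Num.min 0 x)) (D (Num.max 0 x)) = Num.min (D 0) (D x).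
    by have [_|_] := leP 0 x; rewrite // minC.
  have : Num.max (D (Num.min 0 x)) (D (Num.max 0 x)) = Num.max (D 0) (D x).
    by have [_|_] := leP 0 x; rewrite // maxC.
  move=> -> ->; move: Dn Dm; rewrite !ltr_norml => /andP[a1 a2] /andP[b1 b2].
  rewrite ge_min le_max.
  have [nm'|nm'] := ltP n m; [have : (n + 1)%:~R <= m%:~R :> R|have : (m + 1)%:~R <= n%:~R :> R].
  + by rewrite ler_int; lia.
  + rewrite intrD => nm1; apply/andP; split; apply/orP; [left|right]; lra.
  + by rewrite ler_int; lia.
  + rewrite intrD => nm1; apply/andP; split; apply/orP; [right|left]; lra.
by have := nohalf z (Num.min n m); rewrite Dz eqxx.
Qed.

Lemma lift_of_unique f F H : lift_of f F -> lift_of f H ->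
  exists n : int, H = fun x => F x + n%:~R.
Proof.
move=> [dF FE] [dH HE].
have HFZ x : exists n : int, H x - F x = n%:~R.
  by apply/intrP/circle_piE; rewrite HE FE.
have [|||n hn] := @degree1_close_int (fun x => H x - F x) (1 / 4).
- by move=> x; apply: cvgB; [case: dH => + _ _|case: dF => + _ _]; apply.
- by [].
- by move=> x; have [n nE] := HFZ x; exists n; rewrite nE subrr normr0; lra.
exists n; apply/funext => x; have := hn x; have [m mE] := HFZ x.
rewrite mE -rmorphB/= -intr_norm => mn.
have /eqP : m - n == 0.
  rewrite -normr_eq0 eq_le normr_ge0 andbT -ltzD1 add0r -(ltr_int R).
  by rewrite (lt_le_trans mn)//; lra.
by move/eqP; rewrite subr_eq0 => /eqP <-; rewrite -mE subrKC.
Qed.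

(** An arbitrary lift of [f] differs from [H] by almost an integer, the same one everywhere by
    [degree1_close_int]; subtracting it gives the close lift. *)
Lemma lift_of_close f g H e : e <= 1 / 4 ->
  (forall x, circle_dist (fun_of_homeoS1 f x) (fun_of_homeoS1 g x) < e) ->
  lift_of g H -> exists2 F, lift_of f F & forall x, `|F x - H x| < e.
Proof.
move=> e4 fg [dH HE]; have [F [dF FE]] := lift_exists f.
have [|||n hn] := @degree1_close_int (fun x => F x - H x) e.
- by move=> x; apply: cvgB; [case: dF => + _ _|case: dH => + _ _]; apply.
- by [].
- move=> x; have := fg (circle_pi x); rewrite -FE -HE.
  move=> /circle_dist_lt[a [b [/circle_piE/intrP[k ak] /circle_piE/intrP[l bl] ab]]].
  exists (l - k); rewrite rmorphB/= -ak -bl.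
  by rewrite (_ : _ - _ = a - b)//; ring.
exists (fun x => F x + (- n)%:~R); first exact: lift_of_addint.
by move=> x; rewrite rmorphN/= addrAC.
Qed.

End lifts.

(** * Iterates of the translates of a lift *)

Section translated_iterates.
Context {R : realType}.
Implicit Types (F H : R -> R) (p : int).

Definition shift F (t : R) : R -> R := fun x => F x + t.

Lemma iter_ge F H (d : R) : degree1 F -> 0 <= d ->
  (forall x, F x + d <= H x) ->
  forall n x, iter n.+1 F x + d <= iter n.+1 H x.
Proof.
move=> dF d0 FH; elim=> [|n ih] x; first exact: FH.
rewrite iterS [leRHS]iterS (le_trans _ (FH _))// lerD2r degree1_le//.
by rewrite (le_trans _ (ih x))// lerDl.
Qed.

(** The last addition contributes [t - s], and the earlier ones help by monotonicity. With [q]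
    standing for [q + 1] iterations, period zero is excluded. *)
Lemma iter_shift_ge F q (s t x : R) : degree1 F -> s <= t ->
  iter q.+1 (shift F s) x + (t - s) <= iter q.+1 (shift F t) x.
Proof.
move=> dF st; apply: iter_ge; first exact: degree1_add.
- by rewrite subr_ge0.
- by move=> y; rewrite /shift -addrA subrKC.
Qed.

Lemma iter_shift_lt F q (s t x : R) : degree1 F -> s < t ->
  iter q.+1 (shift F s) x < iter q.+1 (shift F t) x.
Proof.
move=> dF st; rewrite (lt_le_trans _ (iter_shift_ge q x dF (ltW st)))//.
by rewrite ltrDl subr_gt0.
Qed.

Lemma iter_shift_continuous F q (x : R) : degree1 F ->
  continuous (fun t => iter q (shift F t) x).
Proof.
move=> dF; have [cF _ _] := dF.
elim: q => [|q ih] t /=; first exact: cvg_cst.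
rewrite {1}/shift; apply: cvgD; last exact: cvg_id.
by apply: (@continuous_comp _ _ _ (fun t => iter q (shift F t) x) F);
  [exact: ih|exact: cF].
Qed.

Lemma shift_root_exists F q p x : degree1 F ->
  exists t, iter q.+1 (shift F t) x = x + p%:~R.
Proof.
move=> dF; pose c := iter q.+1 (shift F 0) x; pose v := x + p%:~R.
(* At the parameters [- n] and [n] the iterate has moved from [c] by at least [n], down and up, so
   [v] lies in between. *)
pose n := `|v - c|.
have n0 : 0 <= n by exact: normr_ge0.
have [|||t _ tE] := @IVT R (fun t => iter q.+1 (shift F t) x) (- n) n v.
- lra.
- by apply: continuous_subspaceT; exact: iter_shift_continuous.
- have := iter_shift_ge q x dF n0; rewrite subr0 -/c => h1.
  have nn : - n <= 0 by lra.
  have := iter_shift_ge q x dF nn; rewrite sub0r opprK -/c => h2.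
  have : `|v - c| <= n by []; rewrite ler_norml => /andP[h3 h4].
  by rewrite ge_min le_max; apply/andP; split; apply/orP; [left|right]; lra.
by exists t.
Qed.

(* For q.+1 iterates, x is a fixed point modulo the translation by p exactly
   for the parameter tau x; so the fixed points are the level sets of tau. *)
Definition tau F q p (x : R) : R :=
  xget 0 [set t | iter q.+1 (shift F t) x = x + p%:~R].

Lemma tauP F q p x : degree1 F ->
  iter q.+1 (shift F (tau F q p x)) x = x + p%:~R.
Proof.
move=> dF; have [t tE] := shift_root_exists q p x dF.
exact: (xgetI (0 : R) (P := [set t | iter q.+1 (shift F t) x = x + p%:~R]) tE).
Qed.

Lemma tau_lt F q p x t : degree1 F ->
  (x + p%:~R < iter q.+1 (shift F t) x) = (tau F q p x < t).
Proof.
move=> dF; apply/idP/idP => [|h]; last first.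
  by rewrite -(tauP q p x dF) iter_shift_lt.
rewrite -{1}(tauP q p x dF) ltNge; apply: contraNlt; rewrite le_eqVlt.
move=> /predU1P[->//|/(iter_shift_lt q x dF)/ltW//].
Qed.

Lemma tau_gt F q p x t : degree1 F ->
  (iter q.+1 (shift F t) x < x + p%:~R) = (t < tau F q p x).
Proof.
move=> dF; apply/idP/idP => [|h]; last first.
  by rewrite -(tauP q p x dF) iter_shift_lt.
rewrite -{1}(tauP q p x dF) ltNge; apply: contraNlt; rewrite le_eqVlt.
move=> /predU1P[->//|/(iter_shift_lt q x dF)/ltW//].
Qed.

Lemma tau_eq F q p x t : degree1 F ->
  iter q.+1 (shift F t) x = x + p%:~R <-> tau F q p x = t.
Proof.
move=> dF; split=> [tE|<-]; last exact: tauP.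
by apply/eqP; rewrite eq_le !leNgt -tau_gt// -tau_lt// tE ltxx.
Qed.

(* So tau is the difference of the identity and a nondecreasing function. *)
Lemma tau_lipr F q p x y : degree1 F -> x <= y ->
  tau F q p y - tau F q p x <= y - x.
Proof.
move=> dF xy; set s := tau F q p y; set t := tau F q p x.
have [st|/ltW ts] := leP s t; first by rewrite (@le_trans _ _ 0)// ?subr_le0// subr_ge0.
have := iter_shift_ge q y dF ts; rewrite tauP//.
have : iter q.+1 (shift F t) x <= iter q.+1 (shift F t) y.
  by rewrite degree1_le//; exact/degree1_iter/degree1_add.
rewrite tauP//; lra.
Qed.

(** Comparing [tau] at [x] with a fixed [t] is a strict inequality on an iterate, hence an open
    condition on [x]; apply this with [t] at distance [e] on either side. *)
Lemma tau_continuous F q p : degree1 F -> continuous (tau F q p).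
Proof.
move=> dF x; have cN t : continuous (fun y => iter q.+1 (shift F t) y - (y + p%:~R)).
  move=> y; have [cF _ _] : degree1 (iter q.+1 (shift F t)).
    exact/degree1_iter/degree1_add.
  apply: cvgB; first exact: cF.
  by apply: cvgD; [exact: cvg_id|exact: cvg_cst].
apply/cvgrPdist_lt => e e0; near=> y; rewrite distrC ltr_norml.
rewrite ltrBrDl -tau_gt// ltrBlDl -tau_lt//; apply/andP; split.
- rewrite -subr_lt0; near: y.
  apply: (cN (tau F q p x + - e) x [set z | z < 0]).
  apply: lt_nbhsl; rewrite subr_lt0 tau_gt//; lra.
- rewrite -subr_gt0; near: y.
  apply: (cN (tau F q p x + e) x [set z | 0 < z]).
  apply: lt_nbhsr; rewrite subr_gt0 tau_lt//; lra.
Unshelve. all: by end_near. Qed.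

Definition has_root F q p (a b : R) :=
  exists x, a <= x <= b /\ iter q.+1 F x = x + p%:~R.

Lemma shift0 F : shift F 0 = F.
Proof. by apply/funext => x; rewrite /shift addr0. Qed.

(** The inequalities with slack [d] survive uniform approximation. They say that the absolute value
    of [tau] goes below every [d] on [a, b]; its minimum on this compact interval is then 0. *)
Lemma has_root_approx F q p a b : degree1 F ->
  has_root F q p a b <-> forall d, 0 < d -> exists x, [/\ a <= x <= b,
    iter q.+1 (shift F (- d)) x < x + p%:~R &
    x + p%:~R < iter q.+1 (shift F d) x].
Proof.
move=> dF; split=> [[x [xab Fx]] d d0|h].
  have t0 : tau F q p x = 0 by apply/tau_eq => //; rewrite shift0.
  by exists x; rewrite tau_gt// tau_lt// t0 d0 oppr_lt0 d0.
have [||c] := @EVT_min R (fun x => `|tau F q p x|) a b.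
- by have [x [/andP[ax xb] _ _]] := h _ ltr01; exact: le_trans xb.
- apply: continuous_subspaceT => x; apply: cvg_norm; exact: tau_continuous.
rewrite in_itv/= => cab cmin; exists c; split=> //.
rewrite -[F in LHS]shift0; apply/tau_eq => //; apply/eqP; rewrite -normr_le0.
apply/ler_addgt0Pl => d d0; rewrite addr0.
have [x [xab]] := h d d0; rewrite tau_gt// tau_lt// => h1 h2.
have := cmin x; rewrite in_itv/= => /(_ xab) /le_trans; apply.
by rewrite ltW// ltr_norml h1 h2.
Qed.

Definition uniformly_closed (Q : (R -> R) -> Prop) := forall F, degree1 F ->
  (forall e, 0 < e -> exists H, [/\ degree1 H, Q H & forall x, `|F x - H x| < e]) ->
  Q F.

(** The map [shift F (d + e)] lies strictly above [shift H d], and monotonicity of the latter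
    carries this through the iteration. *)
Lemma iter_shift_close F H q (d e x : R) : degree1 H ->
  (forall y, `|F y - H y| < e) ->
  iter q.+1 (shift H d) x < iter q.+1 (shift F (d + e)) x.
Proof.
move=> dH FH; have dH' : degree1 (shift H d) by exact: degree1_add.
elim: q => [|q ih].
  have := FH x; rewrite ltr_norml /= /shift => /andP[]; lra.
rewrite iterS [ltRHS]iterS; set y := iter q.+1 (shift F _) x in ih *.
apply: lt_trans (_ : shift H d y < _); first by rewrite degree1_mono.
by have := FH y; rewrite ltr_norml /shift => /andP[]; lra.
Qed.

Lemma has_root_closed q p a b : uniformly_closed (fun F => has_root F q p a b).
Proof.
move=> F dF h; apply/has_root_approx => // d d0.
have d20 : 0 < d / 2 by rewrite divr_gt0.
have [H [dH /has_root_approx + FH]] := h _ d20.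
move=> /(_ dH _ d20)[x [xab x1 x2]]; exists x; split => //.
- have : iter q.+1 (shift F (- d)) x < iter q.+1 (shift H (- d + d / 2)) x.
    by apply: (@iter_shift_close H F) => // y; rewrite distrC.
  rewrite (_ : - d + d / 2 = - (d / 2)); last by field.
  by move=> /lt_trans; apply.
- apply: (lt_trans x2).
  have := iter_shift_close q (d / 2) x dH FH.
  by rewrite -splitr.
Qed.

End translated_iterates.

(** * Borel sets of homeomorphisms and random rotations *)

Section borel_lift_sets.
Context {R : realType}.
Local Notation G := (homeoS1 R).
Local Notation Gborel := (g_sigma_algebraType (@open G)).

Definition lifted (Q : (R -> R) -> Prop) : set G :=
  [set f | exists2 F, lift_of f F & Q F].

(* On a window of width less than 1 for the value at 0, lifts are unique. *)
Definition lifted_window (a : R) (Q : (R -> R) -> Prop) : set G :=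
  lifted (fun F => a <= F 0 <= a + 1 / 2 /\ Q F).

(** Every element of the window near [f] has a lift close to some lift of [f]. The lifts of [f]
    obtained at different precisions differ at 0 by less than 1/2 + 1/8 + 1/8, hence coincide, so a
    single one serves all precisions. *)
Lemma closed_lifted_window a Q : uniformly_closed Q ->
  closed (lifted_window a Q).
Proof.
move=> Qc f fB.
have near_f e : 0 < e -> e <= 1 / 8 -> exists F H, [/\ lift_of f F,
    degree1 H, Q H, a <= H 0 <= a + 1 / 2 & forall x, `|F x - H x| < e].
  move=> e0 e8; have [|g [[H Hg [Ha QH]] /= fg]] := fB
    [set g : G | forall x, circle_dist (fun_of_homeoS1 f x) (fun_of_homeoS1 g x) < e].
    by apply/nbhs_homeoS1P; exists e.
  have [|F Ff FH] := lift_of_close _ fg Hg; first lra.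
  by exists F, H; split => //; exact: lift_of_degree1 Hg.
have e8 : 0 < 1 / 8 :> R by rewrite divr_gt0.
have [F [H [Ff dH QH Ha FH]]] := near_f _ e8 (lexx _).
have key e : 0 < e -> exists H, [/\ degree1 H, Q H, a <= H 0 <= a + 1 / 2 &
    forall x, `|F x - H x| < e].
  move=> e0; have m0 : 0 < Num.min e (1 / 8) by rewrite lt_min e0.
  have [|F' [H' [Ff' dH' QH' Ha' FH']]] := near_f _ m0.
    by rewrite ge_min lexx orbT.
  have [n FE] := lift_of_unique Ff Ff'.
  exists H'; split=> // x.
  suff n0 : n = 0.
    have := FH' x; rewrite FE n0 addr0 => /lt_le_trans; apply.
    by rewrite ge_min lexx.
  have n1 : `|n| < 1.
    rewrite -(ltr_int R) intr_norm.
    have := FH' 0; rewrite FE lt_min => /andP[_].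
    move: (FH 0) Ha Ha'; rewrite !ltr_norml.
    by move=> /andP[h1 h2] /andP[h3 h4] /andP[h5 h6] /andP[h7 h8]; apply/andP; lra.
  by lia.
exists F => //; split; last first.
  apply: Qc => [|e e0]; first exact: lift_of_degree1 Ff.
  by have [H' [dH' QH' _ FH']] := key e e0; exists H'.
by apply/andP; split; apply/ler_addgt0Pl => e e0;
  have [H' [_ _ /andP[h1 h2] /(_ 0)]] := key e e0;
  rewrite ltr_norml => /andP[h3 h4]; lra.
Qed.

Lemma borel_closed (A : set G) : closed A -> borel A.
Proof.
move=> cA; rewrite -[A]setCK; apply: (@measurableC _ Gborel).
by apply: sub_sigma_algebra; exact: closed_openC.
Qed.

Lemma liftedE Q : lifted Q = \bigcup_(j : int) lifted_window (j%:~R / 2) Q.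
Proof.
apply/seteqP; split=> [f [F Ff QF]|f [j _ [F Ff [_ QF]]]]; last by exists F.
exists (Num.floor (F 0 * 2)) => //; exists F => //; split=> //.
have /andP[] := floor_itv (F 0 * 2); rewrite intrD; lra.
Qed.

(** With [lifted] alone the lift could vary with [n]; the window forces one lift for all [n]. *)
Lemma lifted_window_bigcap a (Q : nat -> (R -> R) -> Prop) :
  lifted_window a (fun F => forall n, Q n F) =
  \bigcap_n lifted_window a (Q n).
Proof.
apply/seteqP; split=> [f [F Ff [Fa QF]] n _|f h]; first by exists F.
have [F Ff [Fa QF]] := h 0%N I; exists F => //; split=> // n.
have [F' Ff' [Fa' QF']] := h n I.
have [m FE] := lift_of_unique Ff Ff'.
suff m0 : m = 0 by have -> : F = F' by rewrite FE m0; apply/funext => x; rewrite addr0.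
move: Fa Fa'; rewrite FE => /andP[h1 h2] /andP[h3 h4].
have : `|m| < 1; last by lia.
by rewrite -(ltr_int R) intr_norm ltr_norml; lra.
Qed.

Lemma lifted_window_bigcup a (I : Type) (Q : I -> (R -> R) -> Prop) :
  lifted_window a (fun F => exists i, Q i F) =
  \bigcup_i lifted_window a (Q i).
Proof.
apply/seteqP; split=> [f [F Ff [Fa [i QF]]]|f [i _ [F Ff [Fa QF]]]].
- by exists i => //; exists F.
- by exists F => //; split=> //; exists i.
Qed.

Lemma borel_lifted Q : (forall a, borel (lifted_window a Q)) ->
  borel (lifted Q).
Proof.
move=> bQ; rewrite liftedE.
by apply: (@countable_bigcupT_measurable _ Gborel) => // j; exact: bQ.
Qed.

Definition conj_invariant (Q : (R -> R) -> Prop) := forall F H K, degree1 F ->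
  degree1 H -> degree1 K -> cancel H K -> cancel K H -> Q F -> Q (H \o F \o K).

Lemma lifted_conj Q f g : conj_invariant Q -> lifted Q f -> lifted Q (f ^ g)%g.
Proof.
move=> Qc [F Ff QF]; have [H Hg] := lift_exists g.
have [K dK [HK KH]] := degree1_inv (lift_of_degree1 Hg).
exists (K \o F \o H); last first.
  by apply: Qc => //; [exact: lift_of_degree1 Ff|exact: lift_of_degree1 Hg].
rewrite /conjg mulgA; apply: lift_of_comp => //; apply: lift_of_comp => //.
exact: lift_of_inv Hg dK KH.
Qed.

End borel_lift_sets.

(** * Random rotations as witnesses of Haar nullity *)

Section rotations.
Context {R : realType}.
Local Notation G := (homeoS1 R).
Local Notation Gborel := (g_sigma_algebraType (@open G)).
Local Notation mu := (@lebesgue_measure R).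

Definition rotation (t : measurableTypeR R) : Gborel :=
  sval (cid (homeo_of_degree1 (degree1_add t degree1_id))).

Lemma lift_of_rotation t : lift_of (rotation t : G) (shift id t).
Proof. exact: svalP (cid (homeo_of_degree1 _)). Qed.

(** The map is 1-Lipschitz for the uniform distance, so preimages of open sets are open. *)
Lemma measurable_rotation_mul (k : G) :
  measurable_fun setT (fun t : measurableTypeR R => (rotation t * k)%g : Gborel).
Proof.
apply: (@measurability _ _ _ Gborel _ _ (@open G)) => // _ [U oU <-]; rewrite setTI.
apply: open_measurable; rewrite openE => t Ut.
have /nbhs_homeoS1P[e e0 eU] : nbhs (rotation t * k)%g U.
  by apply: open_nbhs_nbhs.
apply/nbhs_ballP; exists e => //= s ts; apply: eU => x /=.
have rE r : fun_of_homeoS1 (rotation r * k)%g x =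
    circle_pi (shift id r (repr (fun_of_homeoS1 k x))).
  by rewrite (lift_of_rotation r).2 circle_reprK.
rewrite !rE; apply/circle_dist_lt.
exists (shift id t (repr (fun_of_homeoS1 k x))).
exists (shift id s (repr (fun_of_homeoS1 k x))); split => //.
by rewrite /shift (_ : _ - _ = t - s)//; ring.
Qed.

Lemma measurable_rotation : measurable_fun setT rotation.
Proof.
have := measurable_rotation_mul 1%g; rewrite (_ : (fun _ => _) = rotation)//.
by apply/funext => t; rewrite mulg1.
Qed.

HB.instance Definition _ :=
  isMeasurableFun.Build _ _ _ _ rotation measurable_rotation.

Lemma negligible_bigcup_int (A : int -> set R) :
  (forall j, mu.-negligible (A j)) -> mu.-negligible (\bigcup_j A j).
Proof.
move=> nA; apply: negligibleS
  (@negligible_bigcup _ _ _ mu (fun n => A (odflt 0 (unpickle n))) _) => //.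
by move=> t [j _ At]; exists (pickle j) => //; rewrite pickleK.
Qed.

(* Conjugation by g turns [g^-1 r h^-1] into [r (h^-1 g^-1)], so only the right
   translates of the family of rotations matter. *)
Lemma haar_null_lifted (Q : (R -> R) -> Prop) :
  borel (lifted Q) -> conj_invariant Q ->
  (forall F, degree1 F -> mu.-negligible [set t | Q (shift F t)]) ->
  forall f, lifted Q f -> haar_null R (conjugacy_class f).
Proof.
move=> bQ Qc Qn f Qf; exists (lifted Q).
  by move=> _ [g _ <-]; exact: lifted_conj.
split=> //; exists (distribution (uniform_prob (@ltr01 R)) rotation) => g h.
pose k := (h^-1 * g^-1)%g : G.
pose N := (fun t : measurableTypeR R => (rotation t * k)%g : Gborel) @^-1` lifted Q.
change (uniform_prob (@ltr01 R) (rotation @^-1` translate g (lifted Q) h) = 0%E).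
have -> : rotation @^-1` translate g (lifted Q) h = N.
  apply/seteqP; split=> t /=.
    move=> [b Qb bE]; rewrite /N /preimage /=.
    have -> : (rotation t * k = b ^ g^-1)%g.
      by rewrite -[rotation t]bE /k /conjg invgK -!mulgA mulVKg.
    exact: lifted_conj.
  move=> Qt; exists (g^-1 * rotation t * h^-1)%g; last first.
    by rewrite !mulgA mulgV mul1g mulgVK.
  have -> : (g^-1 * rotation t * h^-1)%g = ((rotation t * k) ^ g)%g.
    by rewrite /conjg /k -!mulgA mulVg mulg1.
  exact: lifted_conj.
have mN : measurable N by rewrite -[N]setTI; exact: measurable_rotation_mul.
(* The uniform law is absolutely continuous, so it suffices that [N] is Lebesgue negligible. *)
have /null_content_dominatesP := dominates_uniform_prob (@ltr01 R).
apply => //; apply: measure_negligible => //.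
have [F Fk] := lift_exists k.
(* Every lift of [rotation t * k] is [F + t] plus an integer, so [N] is covered by one negligible
   set per integer [j]. *)
apply: negligibleS
  (negligible_bigcup_int (A := fun j => [set t | Q (shift (fun x => F x + j%:~R) t)]) _).
  move=> t [H Ht QH].
  have [n HE] := lift_of_unique (lift_of_comp (lift_of_rotation t) Fk) Ht.
  exists n => //=; rewrite (_ : shift _ _ = H)// HE; apply/funext => x.
  by rewrite /shift /= addrAC.
by move=> j; apply: Qn; apply: degree1_add; exact: lift_of_degree1 Fk.
Qed.

End rotations.

(** * Homeomorphisms without periodic points *)

Section no_periodic_orbit.
Context {R : realType}.
Local Notation mu := (@lebesgue_measure R).
Implicit Types (F H K : R -> R) (p : int).

Lemma no_fix_sign K (A : set R) : continuous K -> is_interval A ->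
  (forall x, A x -> K x <> x) ->
  (forall x, A x -> x < K x) \/ (forall x, A x -> K x < x).
Proof.
move=> cK iA nK.
have [xK|/existsNP[a /not_implyP[Aa /negP]]] :=
  pselect (forall x, A x -> x < K x); first by left.
rewrite -leNgt => Ka; right => b Ab; rewrite ltNge; apply/negP => Kb.
have [|||z] := @IVT R (fun x => K x - x) (Num.min a b) (Num.max a b) 0.
- by rewrite ge_min le_max lexx.
- by apply: continuous_subspaceT => x; apply: cvgB; [exact: cK|exact: cvg_id].
- by rewrite ge_min le_max !subr_le0 !subr_ge0; case: (leP a b) => ab; rewrite Ka Kb ?orbT.
rewrite in_itv/= => zab /eqP; rewrite subr_eq0 => /eqP; apply: nK.
by move: zab; case: (leP a b) => ab /andP[az zb];
  [apply: (iA a b)|apply: (iA b a)] => //; rewrite az zb.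
Qed.

(** Pigeonhole: two of the first [N + 1] terms fall in the same cell of length [e]. *)
Lemma bounded_seq_close (u : nat -> R) (b e : R) : (forall n, `|u n| <= b) ->
  0 < e -> exists m n, (m < n)%N /\ `|u m - u n| < e.
Proof.
move=> ub e0; pose v n := Num.truncn ((u n + b) / e).
have ub0 n : 0 <= (u n + b) / e.
  by rewrite divr_ge0 ?(ltW e0)//; have := ub n; rewrite ler_norml => /andP[]; lra.
pose N := (Num.truncn (2 * b / e)).+1.
have vN n : (v n < N)%N.
  rewrite ltnS le_truncn// ler_pM2r ?invr_gt0//.
  by have := ub n; rewrite ler_norml => /andP[]; lra.
pose g (i : 'I_N.+1) : 'I_N := Ordinal (vN i).
have /injectivePn[i [j ij gij]] : ~~ injectiveb g.
  by apply/negP => /injectiveP/leq_card; rewrite !card_ord ltnn.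
have vij : v i = v j by case: gij.
have uij : `|u i - u j| < e.
  have /andP[a1 a2] := truncn_itv (ub0 i); have /andP[b1 b2] := truncn_itv (ub0 j).
  move: a1 a2 b1 b2; rewrite -/(v i) -/(v j) vij -natr1.
  rewrite ler_pdivlMr// ltr_pdivrMr// ler_pdivlMr// ltr_pdivrMr// => a1 a2 b1 b2.
  by rewrite ltr_norml; apply/andP; split; lra.
have [ltij|ltji|/val_inj ijE] := ltngtP i j.
- by exists i, j.
- by exists j, i; rewrite distrC.
- by rewrite ijE eqxx in ij.
Qed.

(** Two fractional parts along the orbit of 0 are close; the earlier orbit point is [y], and the
    integer parts give [p]. *)
Lemma close_return F e : 0 < e ->
  exists k y p, `|iter k.+1 F y - (y + p%:~R)| < e.
Proof.
move=> e0; pose y n := iter n F 0.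
pose u n := y n - (Num.floor (y n))%:~R.
have u1 n : `|u n| <= 1.
  have := floor_itv (y n); rewrite intrD /u => /andP[h1 h2].
  by rewrite ler_norml; apply/andP; split; lra.
have [m [n [mn umn]]] := bounded_seq_close u1 e0.
exists (n - m.+1)%N, (y m), (Num.floor (y n) - Num.floor (y m)).
have -> : iter (n - m.+1).+1 F (y m) = y n.
  by rewrite /y -iterD (_ : _ + _ = n)%N//; lia.
rewrite distrC (_ : _ - _ = u m - u n)// /u rmorphB/=; ring.
Qed.

Lemma iter_conj F H K n x : cancel H K -> cancel K H ->
  iter n (H \o F \o K) x = H (iter n F (K x)).
Proof. by move=> HK KH; elim: n => [|n /= ->]; rewrite ?KH ?HK. Qed.

(* The set of rationals below the rotation number; the condition below says
   that F has the same rotation number as F0. *)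
Definition below_rotation F0 q p := forall x, x + p%:~R < iter q.+1 F0 x.

Definition same_rotation F0 F := forall q p x,
  (below_rotation F0 q p -> x + p%:~R <= iter q.+1 F x) /\
  (~ below_rotation F0 q p -> iter q.+1 F x <= x + p%:~R).

Lemma tau_le F q p x t : degree1 F ->
  (x + p%:~R <= iter q.+1 (shift F t) x) = (tau F q p x <= t).
Proof. by move=> dF; rewrite leNgt tau_gt// -leNgt. Qed.

Lemma tau_ge F q p x t : degree1 F ->
  (iter q.+1 (shift F t) x <= x + p%:~R) = (t <= tau F q p x).
Proof. by move=> dF; rewrite leNgt tau_lt// -leNgt. Qed.

(** The condition on [F] consists of weak inequalities between iterates and translations, which pass
    to uniform limits. *)
Lemma same_rotation_closed F0 : uniformly_closed (same_rotation F0).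
Proof.
move=> F dF h q p x; rewrite -(shift0 F) tau_le// tau_ge//; split=> c;
  apply/ler_addgt0Pl => e e0; have [H [dH /(_ q p x)[h1 h2] FH]] := h e e0.
- rewrite addr0 -tau_le// -[e]add0r; apply/ltW.
  by apply: le_lt_trans (iter_shift_close q 0 x dH FH); rewrite shift0 h1.
- rewrite -lerBlDl sub0r -tau_ge//; apply/ltW.
  apply: (@lt_le_trans _ _ (iter q.+1 (shift H (- e + e)) x)).
    by apply: (@iter_shift_close _ H F) => // y; rewrite distrC.
  by rewrite addNr shift0 h2.
Qed.

Lemma same_rotation_conj F0 : conj_invariant (same_rotation F0).
Proof.
move=> F H K dF dH dK HK KH h q p x; rewrite iter_conj//.
have -> : x + p%:~R = H (K x + p%:~R) by rewrite degree1_int// KH.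
by rewrite !degree1_le//; exact: h.
Qed.

(** At most one [t] qualifies. For [s < t] a close return of the midpoint map, within [(t - s) / 2]
    of [y + p], becomes an iterate strictly below [y + p] for [s] and strictly above it for [t], so
    [s] and [t] disagree on [below_rotation F0 k p]. *)
Lemma same_rotation_negligible F0 F : degree1 F ->
  mu.-negligible [set t | same_rotation F0 (shift F t)].
Proof.
move=> dF; have lt_absurd s t : same_rotation F0 (shift F s) ->
    same_rotation F0 (shift F t) -> s < t -> False.
  move=> hs ht st; pose m := (s + t) / 2.
  have e0 : 0 < (t - s) / 2 by rewrite divr_gt0 ?subr_gt0.
  have [k [y [p]]] := close_return (shift F m) e0.
  rewrite ltr_norml => /andP[h1 h2].
  have sm : s <= m by rewrite /m; lra.
  have mt : m <= t by rewrite /m; lra.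
  have := iter_shift_ge k y dF sm; have := iter_shift_ge k y dF mt.
  have [hb|hb] := pselect (below_rotation F0 k p).
    by have := (hs k p y).1 hb; rewrite /m; lra.
  by have := (ht k p y).2 hb; rewrite /m; lra.
have [[s hs]|no] := pselect (exists s, same_rotation F0 (shift F s)); last first.
  by apply: negligibleS (negligible_set0 _) => t ht; apply: no; exists t.
exists [set s]; split => //; first exact: lebesgue_measure_set1.
move=> t ht /=; apply/eqP; rewrite eq_le !leNgt.
by apply/andP; split; apply/negP; exact: lt_absurd.
Qed.

Lemma haar_null_no_periodic f F : lift_of f F ->
  (forall q p x, iter q.+1 F x <> x + p%:~R) ->
  haar_null R (conjugacy_class f).
Proof.
move=> Ff noper; apply: (@haar_null_lifted _ (same_rotation F)).
- apply: borel_lifted => a; apply: borel_closed; apply: closed_lifted_window.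
  exact: same_rotation_closed.
- exact: same_rotation_conj.
- exact: same_rotation_negligible.
(* Without periodic points the sign of [F^(q+1) x - p - x] does not depend on [x], so a failure of
   [below_rotation] at one point reverses the inequality everywhere. *)
exists F => // q p x; split=> [h|/existsNP[y /negP]]; first exact/ltW.
rewrite -leNgt => hy.
have cF : continuous (fun x => iter q.+1 F x - p%:~R).
  have [//] : degree1 (fun x => iter q.+1 F x - p%:~R).
  exact/degree1_add/degree1_iter/(lift_of_degree1 Ff).
have [|||] := @no_fix_sign _ setT cF => //.
- by move=> z _ /eqP; rewrite subr_eq => /eqP/noper.
- by move=> /(_ y I); rewrite ltrBrDr ltNge hy.
- by move=> /(_ x I); rewrite ltrBlDr => /ltW.
Qed.

End no_periodic_orbit.

(** * Homeomorphisms with infinitely many periodic points *)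

Section infinitely_many_periodic_points.
Context {R : realType}.
Local Notation mu := (@lebesgue_measure R).
Implicit Types (F H K : R -> R) (p : int).

Lemma seq_positive_lbound (s : seq R) : (forall d, d \in s -> 0 < d) ->
  exists2 e, 0 < e & forall d, d \in s -> e <= d.
Proof.
elim: s => [|a s ih] hs; first by exists 1.
have [|e e0 es] := ih; first by move=> d ds; apply: hs; rewrite inE ds orbT.
exists (Num.min a e); first by rewrite lt_min e0 hs// mem_head.
move=> d; rewrite inE ge_min => /predU1P[->|/es->]; first by rewrite lexx.
by rewrite orbT.
Qed.

Lemma infinite_set_seq (A : set R) : infinite_set A ->
  exists2 u : nat -> R, injective u & forall k, A (u k).
Proof.
move=> /infiniteP/ppcard_leP[u]; exists u => [i j|k].
- by apply: (@inj _ _ _ u); rewrite inE.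
- exact: (@funS _ _ _ _ u).
Qed.

(* Banach indicatrix: cut [a, b[ into n.+1 pieces. The level t meets the i-th
   one only if t lies in [slab n i], and the lengths of the slabs add up to a
   constant, so by Fatou almost every t lies in boundedly many slabs along some
   subsequence of n. *)
Section indicatrix.
Variables (T : R -> R) (a b : R).
Hypothesis T_lip : forall x y, x <= y -> T y - T x <= y - x.
Hypothesis ab : a <= b.

Let w n : R := (b - a) / n.+1%:R.
Let c n i : R := a + i%:R * w n.
Let slab n i : set (measurableTypeR R) := `[T (c n i.+1) - w n, T (c n i) + w n]%classic.
Let count n (t : measurableTypeR R) : \bar R := (\sum_(i < n.+1) (\1_(slab n i) t)%:E)%E.

Let w_ge0 n : 0 <= w n.
Proof. by rewrite divr_ge0// subr_ge0. Qed.

Let cS n i : c n i.+1 = c n i + w n.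
Proof. by rewrite /c -natr1 mulrDl mul1r addrA. Qed.

(** The one-sided bound is applied from the left end of the piece to [x], and from [x] to the right
    end. *)
Let slab_level n i x t : c n i <= x <= c n i.+1 -> T x = t -> slab n i t.
Proof.
move=> /andP[cx xc] <-; rewrite /slab /= in_itv /=.
have := T_lip cx; have := T_lip xc; move: cx xc; rewrite cS => *.
by apply/andP; split; lra.
Qed.

Let mslab n i : measurable (slab n i).
Proof. exact: measurable_itv. Qed.

Let mcount n : measurable_fun [set: measurableTypeR R] (count n).
Proof.
apply: emeasurable_sum => i; apply/measurable_EFinP.
exact: measurable_indic.
Qed.

Let count_ge0 n t : (0 <= count n t)%E.
Proof. by apply: sume_ge0 => i _; rewrite lee_fin indicE. Qed.

(** The one-sided bound makes [T (c n i) - T (c n i.+1) + 2 * w n] nonnegative, so it is the length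
    of the slab, and these lengths telescope. *)
Let integral_count n :
  (\int[mu]_t count n t = (T a - T b + 2 * (b - a))%:E)%E.
Proof.
rewrite /count ge0_integral_sum//; last first.
  by move=> i; apply/measurable_EFinP; exact: measurable_indic.
transitivity (\sum_(i < n.+1) (T (c n i) - T (c n i.+1) + 2 * w n)%:E)%E.
  apply: eq_bigr => i _; rewrite integral_indic// setIT /slab.
  transitivity (lebesgue_measure
    (`[T (c n i.+1) - w n, T (c n i) + w n]%classic : set R)); first by [].
  rewrite lebesgue_measure_itv/=.
  rewrite lte_fin; have := @T_lip (c n i) (c n i.+1).
  rewrite cS lerDl w_ge0 => /(_ isT) h; case: ltP => k.
    by rewrite -EFinB; congr EFin; lra.
  by have := w_ge0 n => w0; congr EFin; lra.
rewrite sumEFin; congr EFin.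
rewrite big_split/= sumr_const card_ord.
have -> : \sum_(i < n.+1) (T (c n i) - T (c n i.+1)) = T a - T b.
  rewrite -(big_mkord xpredT (fun i => T (c n i) - T (c n i.+1))).
  under eq_bigr do rewrite -opprB.
  rewrite sumrN telescope_sumr// opprB /c mul0r addr0 /w mulrCA divff//.
  by rewrite mulr1 subrKC.
by rewrite -[2 * w n *+ _]mulr_natr /w -!mulrA mulVf ?mulr1 ?pnatr_eq0.
Qed.

(** Take [M] points of the level, pairwise at distance at least [e]. Once [w n < e] they lie in [M]
    different pieces, so [t] lies in at least [M] slabs. *)
Let count_cvg t : infinite_set [set x | a <= x < b /\ T x = t] ->
  count^~ t @ \oo --> +oo%E.
Proof.
move=> /infinite_set_seq[u u_inj uP]; apply/cvgeyPge => A.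
pose M := (Num.truncn A).+1.
have [e e0 eu] : exists2 e, 0 < e & forall i j : 'I_M, i != j -> e <= `|u i - u j|.
  have [|e e0 eu] := @seq_positive_lbound
    [seq `|u ij.1 - u ij.2| | ij : 'I_M * 'I_M <- enum [pred ij : 'I_M * 'I_M | ij.1 != ij.2]].
    move=> d /mapP[[i j] /=]; rewrite mem_enum inE/= => ij ->.
    rewrite normr_gt0 subr_eq0.
    by apply: contra ij => /eqP/u_inj/val_inj ->.
  exists e => // i j ij; apply: eu.
  by apply/mapP; exists (i, j) => //; rewrite mem_enum inE.
exists (Num.truncn ((b - a) / e)) => // n /= nN.
have we : w n < e.
  rewrite /w ltr_pdivrMr// mulrC -ltr_pdivrMr// (lt_le_trans (truncnS_gt _))//.
  by rewrite ler_nat.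
have w0 : 0 < w n.
  have [/andP[au ub] _] := uP 0%N; rewrite divr_gt0//; lra.
pose idx (k : 'I_M) : nat := Num.truncn ((u k - a) / w n).
have idxP k : c n (idx k) <= u k < c n (idx k).+1.
  have [/andP[au ub] _] := uP k.
  have := @truncn_itv _ ((u k - a) / w n).
  rewrite divr_ge0 ?w_ge0 ?subr_ge0// => /(_ isT).
  by rewrite ler_pdivlMr// ltr_pdivrMr// lerBrDl ltrBlDl.
have idx_lt k : (idx k < n.+1)%N.
  have [/andP[au ub] _] := uP k.
  rewrite truncn_lt_nat ?divr_ge0 ?w_ge0 ?subr_ge0//.
  rewrite ltr_pdivrMr// /w mulrCA divff// mulr1; lra.
pose idxo k : 'I_n.+1 := Ordinal (idx_lt k).
have idx_inj : injective idxo.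
  move=> i j [ij]; apply/eqP; apply: contraT => /eu.
  have := idxP i; have := idxP j; rewrite ij cS => /andP[h1 h2] /andP[h3 h4].
  by rewrite leNgt ltr_norml; lra.
rewrite /count sumEFin lee_fin (le_trans (ltW (truncnS_gt _)))// -/M.
rewrite -[M]card_ord -sum1_card natr_sum.
rewrite [leRHS](bigID (fun i => i \in codom idxo))/= ler_wpDr//.
  by apply: sumr_ge0 => i _; rewrite indicE.
rewrite [leRHS](eq_bigr (fun=> 1)); last first.
  move=> i /= /codomP[k ->]; rewrite indicE mem_set//.
  have [_ Tu] := uP k; apply: slab_level Tu.
  by have /andP[h1 /ltW h2] := idxP k; rewrite h1 h2.
by rewrite !sumr_const card_codom.
Qed.

Lemma negligible_infinite_level :
  mu.-negligible [set t | infinite_set [set x | a <= x < b /\ T x = t]].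
Proof.
pose g (t : measurableTypeR R) := limn_einf (count^~ t).
have mg : measurable_fun setT g.
  rewrite /g /limn_einf; apply: measurableT_comp => //.
  by apply: measurable_fun_limn_esup => n; exact: measurableT_comp.
have g_int : mu.-integrable setT g.
  apply/integrableP; split=> //.
  under eq_integral => t _.
    rewrite gee0_abs; last first.
      rewrite /g limn_einf_lim; apply: lime_ge; first exact: is_cvg_einfs.
      by apply: nearW => n; apply: le_ereal_inf_tmp => _ [k _ <-]; exact: count_ge0.
    over.
  have /le_lt_trans := @fatou _ _ _ mu _ measurableT _ mcount
    (fun n t _ => count_ge0 n t).
  apply.
  under [X in limn_einf X]eq_fun do rewrite integral_count.
  by rewrite (cvg_limn_einf_sup (@cvg_cst _ _ _ _ _)).1 ltry.
apply: negligibleS (integrable_ae measurableT g_int) => t /count_cvg tinf /=.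
by move=> /(_ I); rewrite /g (cvg_limn_einf_sup tinf).1.
Qed.

End indicatrix.

Definition root_set q p F : set R := [set x | iter q.+1 F x = x + p%:~R].

(** The window is bounded because the root set of a degree 1 map is 1-periodic, hence infinite as
    soon as it is nonempty. *)
Definition infinitely_many_roots q p F := exists k : nat,
  infinite_set [set x | - k%:R <= x < k%:R /\ root_set q p F x].

Lemma infinitely_many_roots_conj q p :
  conj_invariant (infinitely_many_roots q p).
Proof.
move=> F H K dF dH dK HK KH [k infk].
pose m := maxn (Num.bound `|H (- k%:R)|) (Num.bound `|H k%:R|).
exists m; apply: contra_not infk => finm.
apply: sub_finite_set (finite_image K finm) => x [/andP[kx xk] Fx].
exists (H x); last by rewrite HK.
split; last first.
  by rewrite /root_set /mkset iter_conj// HK (_ : iter _ _ _ = x + p%:~R)// degree1_int.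
have /ltr_normlP[_ h2] : `|H k%:R| < m%:R.
  by rewrite (lt_le_trans (archi_boundP _))// ler_nat leq_maxr.
have : `|H (- k%:R)| < m%:R.
  by rewrite (lt_le_trans (archi_boundP _))// ler_nat leq_maxl.
rewrite ltr_norml => /andP[h1 _].
rewrite (le_trans (ltW h1)) ?degree1_le//= (le_lt_trans _ h2)//.
by rewrite degree1_le// ltW.
Qed.

Lemma infinitely_many_roots_negligible q p F : degree1 F ->
  mu.-negligible [set t | infinitely_many_roots q p (shift F t)].
Proof.
move=> dF; apply: negligibleS
  (@negligible_bigcup _ _ _ mu (fun k : nat => [set t | infinite_set
    [set x | - k%:R <= x < k%:R /\ tau F q p x = t]]) _).
  move=> t [k infk]; exists k => //=; apply: contra_not infk.
  apply: sub_finite_set => x [xk rx]; split=> //; exact/tau_eq.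
move=> k; apply: negligible_infinite_level => [x y|].
  exact: tau_lipr.
by rewrite lerNl; apply: le_trans (_ : 0 <= _); rewrite ?oppr_le0.
Qed.

(* For F of degree 1 the root set is closed and 1-periodic, so it is infinite on
   some bounded interval iff it contains pairs of points arbitrarily close. *)
Definition close_roots q p n (r : rat * rat * rat * rat) F :=
  let: (r1, r2, r3, r4) := r in
  [/\ r2 < r3, ratr r4 - ratr r1 < n.+1%:R^-1 :> R,
    has_root F q p (ratr r1) (ratr r2) & has_root F q p (ratr r3) (ratr r4)].

Lemma close_roots_closed q p n r : uniformly_closed (close_roots q p n r).
Proof.
move: r => [[[r1 r2] r3] r4] F dF h; have [H [_ [h1 h2 _ _] _]] := h 1 ltr01.
split=> //; apply: has_root_closed => // e e0;
  by have [H' [dH' [_ _ ? ?] FH']] := h e e0; exists H'.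
Qed.

Lemma infinitely_many_rootsP q p F : degree1 F -> infinitely_many_roots q p F <->
  forall n, exists r, close_roots q p n r F.
Proof.
move=> dF; split=> [[k /infinite_set_seq[u u_inj uP]] n|h].
  have n0 : 0 < n.+1%:R^-1 :> R by rewrite invr_gt0.
  have uk i : `|u i| <= k%:R.
    by have [/andP[h1 /ltW h2] _] := uP i; rewrite ler_norml h1.
  have [x [y [rx ry xy yx]]] : exists x y, [/\ root_set q p F x,
      root_set q p F y, x < y & y - x < n.+1%:R^-1].
    have [i [j [ij]]] := bounded_seq_close uk n0.
    rewrite ltr_norml ltrNl opprB => /andP[h1 h2].
    have [_ ri] := uP i; have [_ rj] := uP j.
    have [uij|uji|/u_inj ijE] := ltgtP (u i) (u j).
    + by exists (u i), (u j).
    + by exists (u j), (u i).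
    + by rewrite ijE ltnn in ij.
  (* The outer rationals stay within [d] of [x] and [y], which keeps their distance below
     [1 / (n + 1)]. *)
  pose d := (n.+1%:R^-1 - (y - x)) / 2.
  have d0 : 0 < d by rewrite divr_gt0// subr_gt0.
  have [|r1] := @rat_in_itvoo R (x - d) x; first by lra.
  rewrite in_itv/= => /andP[r1l r1r].
  have [|r2] := @rat_in_itvoo R x ((x + y) / 2); first by lra.
  rewrite in_itv/= => /andP[r2l r2r].
  have [|r3] := @rat_in_itvoo R ((x + y) / 2) y; first by lra.
  rewrite in_itv/= => /andP[r3l r3r].
  have [|r4] := @rat_in_itvoo R y (y + d); first by lra.
  rewrite in_itv/= => /andP[r4l r4r].
  exists (r1, r2, r3, r4); split.
  - by rewrite -(ltr_rat R) (lt_trans r2r).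
  - by move: r1l r4r; rewrite /d; move: (n.+1%:R^-1) => e; lra.
  - by exists x; rewrite !ltW.
  - by exists y; rewrite !ltW.
(* Subtracting the floor of [x] moves a close pair into [0, 2[, well inside [-3, 3[; a finite set
   there has a least positive distance [e]. *)
exists 3%N => /finite_seqP[s sE].
have inS z : -3 <= z < 3 -> root_set q p F z -> z \in s.
  by move=> z3 rz; have : [set` s] z by rewrite -sE.
have [|e e0 es] :=
    @seq_positive_lbound [seq d <- [seq y - x | x <- s, y <- s] | 0 < d].
  by move=> d; rewrite mem_filter => /andP[].
have [[[[r1 r2] r3] r4]] := h (Num.truncn e^-1).
move=> [r23 r41 [x [/andP[r1x xr2] rx]] [y [/andP[r3y yr4] ry]]].
have xy : x < y by rewrite (le_lt_trans xr2)// (lt_le_trans _ r3y)// ltr_rat.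
have yxN : y - x < (Num.truncn e^-1).+1%:R^-1 by apply: le_lt_trans r41; lra.
have yxe : y - x < e.
  apply: (lt_trans yxN).
  by rewrite invf_plt ?posrE// truncnS_gt.
have yx1 : y - x < 1.
  apply: (lt_le_trans yxN).
  by rewrite invf_le1// ler1n.
have shiftr z : root_set q p F z -> root_set q p F (z - (Num.floor x)%:~R).
  rewrite /root_set /mkset => rz; rewrite -rmorphN degree1_int.
    by rewrite rz addrAC.
  exact: degree1_iter.
have := floor_itv x; rewrite intrD => /andP[fx xf].
have /es : y - x \in [seq d <- [seq y - x | x <- s, y <- s] | 0 < d].
  rewrite mem_filter subr_gt0 xy/=; apply/allpairsP.
  exists (x - (Num.floor x)%:~R, y - (Num.floor x)%:~R); split => /=.
  - by apply: inS; [lra|exact: shiftr].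
  - by apply: inS; [lra|exact: shiftr].
  - by ring.
by rewrite leNgt yxe.
Qed.

Lemma haar_null_infinitely_many_roots q p f F : lift_of f F ->
  infinitely_many_roots q p F -> haar_null R (conjugacy_class f).
Proof.
move=> Ff Finf; apply: (@haar_null_lifted _ (infinitely_many_roots q p)).
- apply: borel_lifted => a.
  (* This exhibits a countable intersection of countable unions of closed sets. *)
  have -> : lifted_window a (infinitely_many_roots q p) = lifted_window a
      (fun F => forall n, exists r, close_roots q p n r F).
    by apply/seteqP; split=> g [H gH [Ha QH]]; exists H => //; split=> //;
      apply/infinitely_many_rootsP => //; exact: lift_of_degree1 gH.
  rewrite lifted_window_bigcap.
  apply: (@bigcapT_measurable _ (g_sigma_algebraType (@open (homeoS1 R)))) => n.
  rewrite lifted_window_bigcup.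
  apply: (@countable_bigcupT_measurable _ (g_sigma_algebraType (@open (homeoS1 R)))) => // r.
  by apply: borel_closed; apply: closed_lifted_window; exact: close_roots_closed.
- exact: infinitely_many_roots_conj.
- exact: infinitely_many_roots_negligible.
by exists F.
Qed.

End infinitely_many_periodic_points.

(** * Extending conjugacies from a fundamental domain *)

Section equivariant_extension.
Context {R : realType}.
Implicit Types (S Si T Ti K : R -> R) (A B : set R) (n m : int).

Definition increasing_bij S Si :=
  [/\ {homo S : a b / a < b}, cancel S Si & cancel Si S].

Lemma increasing_bij_mono S Si : increasing_bij S Si -> {mono S : a b / a < b}.
Proof. by case=> h _ _; exact: leW_mono (le_mono h). Qed.

Lemma increasing_bij_le S Si : increasing_bij S Si -> {mono S : a b / a <= b}.
Proof. by case=> h _ _; exact: le_mono. Qed.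

Lemma increasing_bij_sym S Si : increasing_bij S Si -> increasing_bij Si S.
Proof.
move=> bS; have [iS SK KS] := bS; split=> // a b ab.
by rewrite -(increasing_bij_mono bS) !KS.
Qed.

Lemma degree1_bij S : degree1 S -> exists Si, increasing_bij S Si.
Proof. by move=> dS; have [Si _ [SK KS]] := degree1_inv dS; exists Si; case: dS. Qed.

Definition ziter S Si n : R -> R :=
  match n with Posz k => iter k S | Negz k => iter k.+1 Si end.

Lemma ziterS S Si n x : increasing_bij S Si ->
  ziter S Si (n + 1) x = S (ziter S Si n x).
Proof.
move=> [_ _ KS]; case: n => n; first by rewrite -PoszD addn1.
have -> : Negz n + 1 = - n%:Z by lia.
by case: n => [|n] /=; rewrite KS.
Qed.

Lemma ziter_ind (P : int -> Prop) : P 0 ->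
  (forall n, P n <-> P (n + 1)) -> forall n, P n.
Proof.
move=> P0 PS; case=> n; first by elim: n => // n /PS; rewrite -addn1 PoszD.
elim: n => [|n ih]; first by apply/PS.
by apply/PS; rewrite (_ : _ + 1 = Negz n)//; lia.
Qed.

Lemma ziter_comm S Si K n x : increasing_bij S Si ->
  (forall y, K (S y) = S (K y)) -> K (ziter S Si n x) = ziter S Si n (K x).
Proof.
move=> bS KS; elim/ziter_ind: n => // n; rewrite !ziterS// KS.
by split=> [->//|]; apply: inc_inj; exact: increasing_bij_le bS.
Qed.

Lemma ziterSr S Si n x : increasing_bij S Si ->
  ziter S Si (n + 1) x = ziter S Si n (S x).
Proof. by move=> bS; rewrite ziterS// ziter_comm. Qed.

Lemma ziterNK S Si n x : increasing_bij S Si ->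
  ziter S Si n (ziter S Si (- n) x) = x.
Proof.
move=> bS; elim/ziter_ind: n x => // n.
have step z : ziter S Si (n + 1) (ziter S Si (- (n + 1)) z) =
    ziter S Si n (ziter S Si (- n) z).
  by rewrite ziterSr// -(ziterS _ _ bS) (_ : - (n + 1) + 1 = - n)//; lia.
by split=> h z; [rewrite step h|rewrite -step h].
Qed.

Lemma ziter_homo S Si n : increasing_bij S Si ->
  {homo ziter S Si n : a b / a < b}.
Proof.
move=> bS a b ab; elim/ziter_ind: n => // n.
by rewrite !ziterS// (increasing_bij_mono bS).
Qed.

Lemma ziter_window S Si n x0 x : increasing_bij S Si ->
  ziter S Si n x0 <= x < ziter S Si (n + 1) x0 ->
  exists2 a, x0 <= a < S x0 & x = ziter S Si n a.
Proof.
move=> bS; rewrite ziterSr// -{1 2}(ziterNK n x bS).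
rewrite (le_mono (ziter_homo _ bS)) (leW_mono (le_mono (ziter_homo _ bS))).
by exists (ziter S Si (- n) x); rewrite ?ziterNK.
Qed.

Lemma ziter_fix S Si n x : increasing_bij S Si -> S x = x -> ziter S Si n x = x.
Proof.
move=> bS Sx; elim/ziter_ind: n => // n; rewrite !ziterS//.
by rewrite -{4}Sx; split=> [->//|]; apply: inc_inj; exact: increasing_bij_le bS.
Qed.

Lemma ziter_lt S Si x n m : increasing_bij S Si -> x < S x -> n < m ->
  ziter S Si n x < ziter S Si m x.
Proof.
move=> bS xS nm; have step k : ziter S Si k x < ziter S Si (k + 1) x.
  by rewrite ziterSr//; exact: ziter_homo.
have -> : m = n + 1 + `|(m - n - 1)%R|%N%:Z by lia.
elim: `|_|%N => [|k ih]; first by rewrite addr0.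
apply: (lt_trans ih); rewrite (_ : _ + k.+1%:Z = n + 1 + k%:Z + 1)//; lia.
Qed.

(** The union of the integer iterates under [S] of the fundamental domain [x0, S x0[. *)
Definition hull S Si (x0 x : R) :=
  exists n, ziter S Si n x0 <= x < ziter S Si (n + 1) x0.

(** If the forward orbit of [x0] never passed [x], its supremum would be a fixed point between them;
    likewise for the infimum of the backward orbit. *)
Lemma hull_no_fix S Si x0 x : increasing_bij S Si -> x0 < S x0 ->
  (forall y, x0 <= y <= x \/ x <= y <= x0 -> S y <> y) -> hull S Si x0 x.
Proof.
move=> bS xS nofix; have [iS SK KS] := bS.
have bSi := increasing_bij_sym bS.
have leS := increasing_bij_le bS; have leSi := increasing_bij_le bSi.
have up : exists k, x < iter k S x0.
  apply: contrapT => /forallNP no; pose A := range (fun k => iter k S x0).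
  have Ax : ubound A x by move=> _ [k _ <-]; rewrite leNgt; apply/negP/no.
  have sA : has_sup A by split; [exists x0; exists 0%N|exists x].
  have As k : iter k S x0 <= sup A by apply: sup_upper_bound => //; exists k.
  apply: (nofix (sup A)).
    by left; rewrite (As 0%N)/= ge_sup//; case: sA.
  apply/le_anti/andP; split.
    rewrite -[leRHS]KS leS ge_sup//; first by case: sA.
    by move=> _ [k _ <-]; rewrite -leS KS; exact: As k.+1.
  rewrite ge_sup//; first by case: sA.
  move=> _ [k _ <-]; apply: le_trans (_ : iter k.+1 S x0 <= _).
    by elim: k => [|k ih]; [exact: ltW|rewrite iterS [leRHS]iterS leS].
  by rewrite iterS leS.
have down : exists k, iter k Si x0 <= x.
  apply: contrapT => /forallNP no; pose A := range (fun k => iter k Si x0).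
  have Ax : lbound A x.
    by move=> _ [k _ <-]; rewrite ltW// ltNge; apply/negP/no.
  have sA : has_inf A by split; [exists x0; exists 0%N|exists x].
  have As k : inf A <= iter k Si x0 by apply: ge_inf; [case: sA|exists k].
  apply: (nofix (inf A)).
    by right; rewrite (As 0%N)/= andbT lb_le_inf//; case: sA.
  apply/le_anti/andP; split.
    rewrite lb_le_inf//; first by case: sA.
    by move=> _ [k _ <-]; rewrite -leSi SK; exact: As k.+1.
  rewrite -leSi SK lb_le_inf//; first by case: sA.
  move=> _ [k _ <-]; apply: le_trans (_ : iter k.+1 Si x0 <= _).
    by rewrite iterS leSi.
  elim: k => [|k ih]; first by rewrite /= -leS KS ltW.
  by rewrite iterS [leRHS]iterS leSi.
have [k1 k1x] := down; have [k2 k2x] := up.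
(* Offsetting the exponent by [k1] makes it a natural number, so a first crossing exists; [j = 0] is
   ruled out by [k1x]. *)
have exP : exists j : nat, x < ziter S Si (j%:Z - k1%:Z) x0.
  by exists (k1 + k2)%N; rewrite (_ : _ - _ = k2%:Z)//; lia.
case: (ex_minnP exP) => -[|j] jx jmin.
  move: jx; rewrite sub0r; case: {+}k1 k1x => [|k] /= + h;
  by rewrite leNgt h.
exists (j%:Z - k1%:Z); apply/andP; split.
  by rewrite leNgt; apply/negP => /jmin; rewrite ltnn.
by rewrite (_ : _ + 1 = j.+1%:Z - k1%:Z)//; lia.
Qed.

Lemma ziter_lex S Si x0 n m a b : increasing_bij S Si -> x0 < S x0 ->
  x0 <= a < S x0 -> x0 <= b < S x0 ->
  (ziter S Si n a < ziter S Si m b) = (n < m) || (n == m) && (a < b).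
Proof.
move=> bS xS.
have lt k l c d : x0 <= c < S x0 -> x0 <= d < S x0 -> k < l ->
    ziter S Si k c < ziter S Si l d.
  move=> /andP[_ cS] /andP[dx _] kl.
  apply: (@lt_le_trans _ _ (ziter S Si (k + 1) x0)).
    by rewrite ziterSr//; exact: ziter_homo.
  apply: (@le_trans _ _ (ziter S Si l x0)).
    move: kl; rewrite -lezD1 le_eqVlt => /predU1P[->//|kl].
    by rewrite ltW// ziter_lt.
  by rewrite (le_mono (ziter_homo _ bS)).
move=> aE bE; have [nm|nm|->] /= := ltgtP n m.
- exact: lt.
- by rewrite ltNge ltW// lt.
- by rewrite (leW_mono (le_mono (ziter_homo _ bS))).
Qed.

Definition order_iso A B (h : R -> R) := [/\ forall x, A x -> B (h x),
  forall x y, A x -> A y -> x < y -> h x < h y &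
  forall y, B y -> exists2 x, A x & h x = y].

Definition conj_on A B K K' h :=
  order_iso A B h /\ forall x, A x -> h (K x) = K' (h x).

(** Send [S^n a] to [T^n (h0 a)] for [a] in the fundamental domain. A map commuting with [S] and
    preserving the domain is then intertwined everywhere once it is on the domain. *)
Lemma hull_extension S Si T Ti x0 y0 h0 :
  increasing_bij S Si -> increasing_bij T Ti -> x0 < S x0 -> y0 < T y0 ->
  order_iso [set x | x0 <= x < S x0] [set y | y0 <= y < T y0] h0 ->
  exists h, conj_on (hull S Si x0) (hull T Ti y0) S T h /\
    forall K K', (forall x, K (S x) = S (K x)) ->
      (forall x, K' (T x) = T (K' x)) ->
      (forall x, x0 <= x < S x0 -> x0 <= K x < S x0) ->
      (forall x, x0 <= x < S x0 -> h0 (K x) = K' (h0 x)) ->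
    forall x, hull S Si x0 x -> h (K x) = K' (h x).
Proof.
move=> bS bT xS yT [h0E h0lt h0onto].
pose r x y := exists n a, [/\ x0 <= a < S x0, x = ziter S Si n a &
  y = ziter T Ti n (h0 a)].
have r_lt x y x' y' : r x y -> r x' y' -> x < x' -> y < y'.
  move=> [n [a [aE -> ->]]] [m [b [bE -> ->]]].
  rewrite (ziter_lex _ _ bS xS)// (ziter_lex _ _ bT yT); [|exact: h0E..].
  by case/orP=> [->//|/andP[-> ab]]; rewrite h0lt ?orbT.
have r_fun x y y' : r x y -> r x y' -> y = y'.
  move=> [n [a [aE -> ->]]] [m [b [bE xE ->]]].
  have : ~~ (ziter S Si n a < ziter S Si m b) by rewrite xE ltxx.
  have : ~~ (ziter S Si m b < ziter S Si n a) by rewrite xE ltxx.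
  rewrite !(ziter_lex _ _ bS xS)//.
  by case: (ltgtP n m) => //= ->; case: (ltgtP a b) => //= ->.
have r_ex x : hull S Si x0 x -> exists y, r x y.
  move=> [n /(ziter_window bS)[a aE ->]].
  by exists (ziter T Ti n (h0 a)), n, a.
(* The default 0 is taken only off the hull, where nothing is claimed. *)
pose h x := xget 0 [set y | r x y].
have hr x : hull S Si x0 x -> r x (h x).
  by move=> /r_ex[y rxy]; exact: (xgetI 0 (P := [set y | r x y]) rxy).
have h_eq x y : r x y -> h x = y.
  move=> rxy; apply: (r_fun x) => //.
  exact: (xgetI 0 (P := [set y | r x y]) rxy).
have r_hull x y : r x y -> hull S Si x0 x /\ hull T Ti y0 y.
  move=> [n [a [aE -> ->]]]; have := h0E _ aE; move: aE => /= /andP[a1 a2] /andP[b1 b2].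
  by split; exists n; rewrite ziterSr// (le_mono (ziter_homo _ _))//
    (leW_mono (le_mono (ziter_homo _ _)))// ?a1 ?b1.
exists h; split; first split; first split.
- by move=> x /hr/r_hull[].
- by move=> x y /hr rx /hr ry; exact: r_lt.
- move=> y [n /(ziter_window bT)[b bE ->]].
  have [a aE ab] := h0onto b bE.
  have rab : r (ziter S Si n a) (ziter T Ti n b) by exists n, a; rewrite ab.
  by exists (ziter S Si n a); [exact: (r_hull _ _ rab).1|exact: h_eq].
- move=> x /hr[n [a [aE xE hE]]]; apply: h_eq; exists (n + 1), a.
  by rewrite !ziterS// -xE -hE.
move=> K K' KS KT KE h0K x /hr[n [a [aE xE hE]]]; apply: h_eq.
exists n, (K a); split; first exact: KE.
  by rewrite -ziter_comm// -xE.
by rewrite h0K// -ziter_comm// -hE.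
Qed.

End equivariant_extension.

(** * Conjugacy between consecutive fixed points *)

Section gap_conjugacy.
Context {R : realType}.
Implicit Types (S Si T Ti K : R -> R).

Lemma hull_gap S Si a b : increasing_bij S Si -> S a = a -> S b = b ->
  (forall x, a < x < b -> x < S x) -> forall x0, a < x0 < b ->
  hull S Si x0 = [set x | a < x < b].
Proof.
move=> bS Sa Sb Sx x0 x0ab; apply/seteqP; split=> [x [n /andP[nx xn]]|x xab] /=.
  move: x0ab => /andP[ax0 x0b].
  rewrite (lt_le_trans _ nx) -?[ltLHS](ziter_fix n bS Sa) ?ziter_homo//=.
  by rewrite (lt_trans xn)// -[ltRHS](ziter_fix (n + 1) bS Sb) ziter_homo.
apply: hull_no_fix => [//||y yx Sy]; first exact: Sx.
have /Sx : a < y < b.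
  by move: x0ab xab yx => /andP[? ?] /andP[? ?] [] /andP[? ?];
    apply/andP; split; lra.
by rewrite Sy ltxx.
Qed.

Lemma affine_order_iso (a b a' b' : R) : a < b -> a' < b' ->
  order_iso [set x | a <= x < b] [set y | a' <= y < b']
    (fun x => a' + (x - a) / (b - a) * (b' - a')).
Proof.
rewrite -subr_gt0 => ab; rewrite -subr_gt0 => ab'.
have img (c d e f x : R) : 0 < d - c -> 0 < f - e -> c <= x < d ->
    e <= e + (x - c) / (d - c) * (f - e) < f.
  move=> cd ef /andP[cx xd]; apply/andP; split.
    by rewrite lerDl mulr_ge0 ?divr_ge0 ?(ltW cd) ?(ltW ef)// subr_ge0.
  rewrite -ltrBrDl gtr_pMl// ltr_pdivrMr// mul1r; lra.
split=> [x /img|x y _ _ xy|y yab]; first exact.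
  by rewrite ltrD2l ltr_pM2r// ltr_pM2r ?invr_gt0// ltrD2r.
exists (a + (y - a') / (b' - a') * (b - a)); first exact: img.
rewrite addrAC subrr add0r mulfK ?gt_eqF// divfK ?gt_eqF//.
by rewrite subrKC.
Qed.

(** One orbit exhausts a gap in both directions, so any increasing bijection of fundamental domains
    extends; the affine one is used, from midpoints. *)
Lemma gap_conj_up S Si T Ti (a b a' b' : R) :
  increasing_bij S Si -> increasing_bij T Ti -> a < b -> a' < b' ->
  S a = a -> S b = b -> T a' = a' -> T b' = b' ->
  (forall x, a < x < b -> x < S x) -> (forall x, a' < x < b' -> x < T x) ->
  exists h, conj_on [set x | a < x < b] [set x | a' < x < b'] S T h.
Proof.
move=> bS bT ab ab' Sa Sb Ta Tb Sx Tx.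
have m : a < (a + b) / 2 < b by apply/andP; split; lra.
have m' : a' < (a' + b') / 2 < b' by apply/andP; split; lra.
have [h [hP _]] := hull_extension bS bT (Sx _ m) (Tx _ m')
  (affine_order_iso (Sx _ m) (Tx _ m')).
by exists h; move: hP; rewrite (hull_gap bS Sa Sb Sx m) (hull_gap bT Ta Tb Tx m').
Qed.

Definition moves (c : bool) K (x : R) := if c then x < K x else K x < x.

Lemma gap_conj c S Si T Ti (a b a' b' : R) :
  increasing_bij S Si -> increasing_bij T Ti -> a < b -> a' < b' ->
  S a = a -> S b = b -> T a' = a' -> T b' = b' ->
  (forall x, a < x < b -> moves c S x) ->
  (forall x, a' < x < b' -> moves c T x) ->
  exists h, conj_on [set x | a < x < b] [set x | a' < x < b'] S T h.
Proof.
case: c => bS bT ab ab' Sa Sb Ta Tb Sx Tx; first exact: (gap_conj_up bS bT).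
(* Downward motion reduces to upward motion of the inverses, and a conjugacy of the inverses
   conjugates the maps. *)
have inv K Ki (c d : R) : increasing_bij K Ki -> K c = c -> K d = d ->
    (forall x, c < x < d -> K x < x) ->
    [/\ Ki c = c, Ki d = d & forall x, c < x < d -> x < Ki x].
  move=> bK Kc Kd Kx; have [_ KKi KiK] := bK.
  have Kic : Ki c = c by rewrite -{1}Kc KKi.
  have Kid : Ki d = d by rewrite -{1}Kd KKi.
  split=> // x /andP[cx xd]; have := Kx (Ki x); rewrite KiK; apply.
  by rewrite -Kic -Kid !(increasing_bij_mono (increasing_bij_sym bK)) cx.
have [Sia Sib Six] := inv _ _ _ _ bS Sa Sb Sx.
have [Tia Tib Tix] := inv _ _ _ _ bT Ta Tb Tx.
have [h [hI hE]] := gap_conj_up (increasing_bij_sym bS) (increasing_bij_sym bT)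
  ab ab' Sia Sib Tia Tib Six Tix.
exists h; split=> // x /= /andP[ax xb]; have [_ SK _] := bS; have [_ TK KT] := bT.
have : h (Si (S x)) = Ti (h (S x)).
  by apply: hE => /=; rewrite -Sa -Sb !(increasing_bij_mono bS) ax.
by rewrite SK => ->; rewrite KT.
Qed.

(** [l] lists the successive fixed points after [a], and [s] is the combinatorial invariant: the
    direction of motion on each gap. *)
Fixpoint gaps K (a : R) (l : seq R) (s : seq bool) : Prop :=
  match l, s with
  | [::], [::] => True
  | b :: l', c :: s' => [/\ a < b, K b = b,
      forall x, a < x < b -> moves c K x & gaps K b l' s']
  | _, _ => False
  end.

Lemma gaps_conj S Si T Ti (a a' : R) l l' s :
  increasing_bij S Si -> increasing_bij T Ti -> S a = a -> T a' = a' ->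
  gaps S a l s -> gaps T a' l' s ->
  exists h, conj_on [set x | a <= x < last a l] [set x | a' <= x < last a' l'] S T h.
Proof.
move=> bS bT; elim: l l' s a a' => [|b l ih] [|b' l'] [|c s] //= a a' Sa Ta.
  move=> _ _; exists id; split; first split.
  - by move=> x /= /andP[h1 h2]; have := le_lt_trans h1 h2; rewrite ltxx.
  - by move=> x y /= /andP[h1 h2]; have := le_lt_trans h1 h2; rewrite ltxx.
  - by move=> x /= /andP[h1 h2]; have := le_lt_trans h1 h2; rewrite ltxx.
  - by move=> x /= /andP[h1 h2]; have := le_lt_trans h1 h2; rewrite ltxx.
move=> [ab Sb Sx gS] [ab' Tb Tx gT].
have [h1 [[h1E h1lt h1onto] h1C]] := gap_conj bS bT ab ab' Sa Sb Ta Tb Sx Tx.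
have [h2 [[h2E h2lt h2onto] h2C]] := ih _ _ _ _ Sb Tb gS gT.
have le_last (K : R -> R) (x : R) m t : gaps K x m t -> x <= last x m.
  by elim: m x t => [|y m IH] x [|d t] //= [xy _ _ /IH]; apply/le_trans/ltW.
have bl := le_last _ _ _ _ gS; have bl' := le_last _ _ _ _ gT.
(* Gluing: [a] goes to [a'], the open gap follows [h1], and the rest from [b] on follows the
   inductive [h2]. *)
pose h x := if x <= a then a' else if x < b then h1 x else h2 x.
have ha : h a = a' by rewrite /h lexx.
have hab x : a < x < b -> h x = h1 x.
  by move=> /andP[ax xb]; rewrite /h leNgt ax xb.
have hbl x : b <= x -> h x = h2 x.
  by move=> bx; rewrite /h !leNgt (lt_le_trans ab bx)/= ltNge bx.
have cases x : a <= x -> [\/ x = a, a < x < b | b <= x].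
  rewrite le_eqVlt => /predU1P[->|ax]; first by constructor 1.
  by have [xb|bx] := ltP x b; [constructor 2; rewrite ax|constructor 3].
have aS := increasing_bij_mono bS.
exists h; split; first split.
- move=> x /= /andP[/cases[->|xab|bx] xl].
  + by rewrite ha lexx (lt_le_trans ab').
  + have /andP[h1a h1b] := h1E _ xab.
    by rewrite hab// (ltW h1a) (lt_le_trans h1b).
  + have /andP[h2a h2b] : b' <= h2 x < last b' l' by apply: h2E; rewrite /= bx.
    by rewrite hbl// h2b (le_trans (ltW ab')).
- move=> x y /= /andP[/cases[->|xab|bx] xl] /andP[/cases[->|yab|by_] yl] xy.
  + by rewrite ltxx in xy.
  + by rewrite ha hab//; have /andP[] := h1E _ yab.
  + rewrite ha hbl// (lt_le_trans ab')//.
    by have /andP[] : b' <= h2 y < last b' l' by apply: h2E; rewrite /= by_.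
  + by case/andP: xab => /(lt_trans xy); rewrite ltxx.
  + by rewrite !hab//; apply: h1lt.
  + rewrite hab// hbl//; apply: (@lt_le_trans _ _ b').
      by have /andP[] := h1E _ xab.
    by have /andP[] : b' <= h2 y < last b' l' by apply: h2E; rewrite /= by_.
  + by have := lt_trans (lt_le_trans ab bx) xy; rewrite ltxx.
  + by case/andP: yab => _ /(lt_trans xy); rewrite ltNge bx.
  + by rewrite !hbl//; apply: h2lt => //=; rewrite ?bx ?by_.
- move=> y /= /andP[]; rewrite le_eqVlt => /predU1P[<- _|ay yl].
    by exists a => //=; rewrite lexx (lt_le_trans ab).
  have [yb|by_] := ltP y b'.
    have [|x /= xab xy] := h1onto y; first by rewrite /= ay.
    exists x; last by rewrite hab.
    by case/andP: xab => ax xb; rewrite /= (ltW ax) (lt_le_trans xb).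
  have [|x /= /andP[bx xl] xy] := h2onto y; first by rewrite /= by_.
  by exists x; [rewrite /= xl (le_trans (ltW ab))|rewrite hbl].
- move=> x /= /andP[/cases[->|xab|bx] xl].
  + by rewrite Sa ha Ta.
  + rewrite [h x]hab// hab ?h1C//.
    by case/andP: xab => ax xb; rewrite -Sa -Sb !aS ax.
  + rewrite [h x]hbl// hbl ?h2C//=; first by rewrite bx.
    by rewrite -Sb (increasing_bij_le bS).
Qed.

Lemma path_le_last (y : R) m : path <%R y m ->
  forall x, x \in y :: m -> x <= last y m.
Proof.
elim: m y => [|z m IH] y /=; first by move=> _ x; rewrite inE => /eqP ->.
move=> /andP[yz pm] x; rewrite inE => /predU1P[->|/(IH _ pm)//].
by rewrite (le_trans (ltW yz))// IH// mem_head.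
Qed.

Lemma gaps_exist K (a : R) l : continuous K -> path <%R a l ->
  (forall x, a < x <= last a l -> K x = x <-> x \in l) ->
  exists s, gaps K a l s.
Proof.
move=> cK; elim: l a => [|b l ih] a /=; first by exists [::].
move=> /andP[ab pl] fixl.
have bl : b <= last b l by rewrite path_le_last// mem_head.
have bmin x : x \in l -> b < x by apply/allP; exact: order_path_min lt_trans pl.
have Kb : K b = b by apply/fixl; [rewrite ab|rewrite mem_head].
have [s gs] : exists s, gaps K b l s.
  apply: ih => // x /andP[bx xl]; rewrite fixl ?(lt_trans ab) ?xl// inE.
  by rewrite gt_eqF.
have [||up|down] := @no_fix_sign _ K [set x | a < x < b] cK.
- move=> x y /= /andP[ax xb] /andP[ay yb] z /andP[xz zy].
  by rewrite (lt_le_trans ax)//= (le_lt_trans zy).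
- move=> x /= /andP[ax xb] /fixl; rewrite ax (le_trans (ltW xb))// => /(_ isT).
  by rewrite inE lt_eqF//= => /bmin/(lt_trans xb); rewrite ltxx.
- by exists (true :: s).
- by exists (false :: s).
Qed.

End gap_conjugacy.

(** * Classes with finitely many periodic points *)

Section coded_classes.
Context {R : realType}.
Local Notation G := (homeoS1 R).
Implicit Types (F H K : R -> R) (f g : G).

Definition power F (q p : nat) : R -> R := fun x => iter q F x - p%:R.

Lemma degree1_power F q p : degree1 F -> degree1 (power F q p).
Proof. by move=> dF; apply: degree1_add; exact: degree1_iter. Qed.

Lemma degree1_natB F x n : degree1 F -> F (x - n%:R) = F x - n%:R.
Proof. by move=> dF; rewrite -[x in RHS](subrK n%:R) degree1_nat// addrK. Qed.

Lemma iter_power F q p n x : degree1 F ->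
  iter n (power F q p) x = iter (n * q) F x - (n * p)%:R.
Proof.
move=> dF; elim: n => [|n ih]; first by rewrite mul0n subr0.
rewrite iterS ih /power degree1_natB; last exact: degree1_iter.
by rewrite -iterD mulSn mulSn natrD; ring.
Qed.

(** Period, numerator, two Bezout coefficients and gap directions; the type is countable, which
    bounds the number of classes. *)
Definition code : Type := (nat * nat * nat * nat * seq bool)%type.

(* When u p - w q = 1, the commuting maps F^q - p and F^u - w generate the same
   group as F and the unit translation. The first one fixes every lift of a
   periodic point, and the second one shifts these by one orbit. *)
Definition coded (k : code) F := let: (q, p, u, w, s) := k in
  (u * p = w * q + 1)%N /\ exists z l,
    [/\ power F q p z = z, gaps (power F q p) z l s & last z l = power F u w z].

Section coded_properties.
Variables (F : R -> R) (q p u w : nat).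
Hypotheses (dF : degree1 F) (upwq : (u * p = w * q + 1)%N).
Let T := power F q p.
Let S := power F u w.

(** Both sides subtract [w p], while the numbers of iterations [w q + 1] and [u p] agree. In
    [power_bezout_1] the iterations agree and the translations differ by 1. *)
Lemma power_bezout_F x : F (iter w T x) = iter p S x.
Proof.
rewrite !iter_power// degree1_natB// -iterS -addn1 -upwq mulnC.
by rewrite [(w * p)%N]mulnC.
Qed.

Lemma power_bezout_1 x : iter q S x = iter u T x + 1.
Proof.
rewrite !iter_power// [(q * u)%N]mulnC [(q * w)%N]mulnC upwq natrD.
by rewrite opprD addrA subrK.
Qed.

Lemma power_comm x : T (S x) = S (T x).
Proof.
have dFi n := degree1_iter n dF.
by rewrite /T /S /power !degree1_natB// -!iterD addnC addrAC.
Qed.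

(** Otherwise [S^q z <= z], whereas [S^q z = T^u z + 1 = z + 1]. *)
Lemma power_fix_lt z : T z = z -> z < S z.
Proof.
move=> Tz; rewrite ltNge; apply/negP => Sz.
have dS := degree1_power u w dF : degree1 S.
have : iter q S z <= z.
  elim: q => [|n ih] //=; apply: le_trans Sz.
  by rewrite degree1_le.
rewrite power_bezout_1.
have -> : iter u T z = z by elim: u => // n /= ->.
by rewrite gerDl ler10.
Qed.

(** A fixed point [x] of [S] would give [T^u x = x - 1], but [T] fixes an integer translate of [z]
    in ]x - 1, x], which [T^u x] cannot pass. *)
Lemma power_no_fix z x : T z = z -> S x <> x.
Proof.
move=> Tz Sx; have dT := degree1_power q p dF : degree1 T.
have : iter q S x = x by elim: q => // n /= ->.
rewrite power_bezout_1 => ux.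
have := floor_itv (x - z); set m := Num.floor _; rewrite intrD => /andP[mx xm].
have : iter u T (z + m%:~R) <= iter u T x.
  by rewrite degree1_le; [lra|exact: degree1_iter].
have -> : iter u T (z + m%:~R) = z + m%:~R.
  by elim: u => // n /= ->; rewrite degree1_int// Tz.
lra.
Qed.

Lemma power_window z x : T z = z -> z <= x < S z -> z <= T x < S z.
Proof.
move=> Tz; have dT := degree1_power q p dF : degree1 T.
by rewrite -{3}Tz -{4}Tz -power_comm degree1_le// degree1_mono.
Qed.

End coded_properties.

Lemma coded_conj k F F' : degree1 F -> degree1 F' -> coded k F -> coded k F' ->
  exists H, degree1 H /\ forall x, H (F x) = F' (H x).
Proof.
move: k => [[[[q p] u] w] s] dF dF' [upwq [z [l [Tz gT lS]]]].
move=> [_ [z' [l' [Tz' gT' lS']]]].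
pose T := power F q p; pose S := power F u w.
pose T' := power F' q p; pose S' := power F' u w.
have [Ti bT] := degree1_bij (degree1_power q p dF).
have [Ti' bT'] := degree1_bij (degree1_power q p dF').
have [Si bS] := degree1_bij (degree1_power u w dF).
have [Si' bS'] := degree1_bij (degree1_power u w dF').
(* By [lS] and [lS'] the intervals carrying [h0] are fundamental domains of [S] and [S'], so [h0]
   extends to the line. *)
have [h0 [h0I h0C]] := gaps_conj bT bT' Tz Tz' gT gT'.
rewrite lS lS' in h0I h0C.
have zS := power_fix_lt dF upwq Tz; have zS' := power_fix_lt dF' upwq Tz'.
have [H [[[_ Hlt Honto] HS] HK]] := hull_extension bS bS' zS zS' h0I.
have hullT x : hull S Si z x.
  by apply: hull_no_fix => // y _; exact: power_no_fix Tz.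
have hullT' x : hull S' Si' z' x.
  by apply: hull_no_fix => // y _; exact: power_no_fix Tz'.
have HT x : H (T x) = T' (H x).
  apply: HK => //; [exact: power_comm|exact: power_comm|].
  by move=> y; exact: power_window.
have iterH A B n x : (forall y, H (A y) = B (H y)) ->
    H (iter n A x) = iter n B (H x).
  by move=> AB; elim: n => //= n <-.
(* Writing [y = T^w x] gives [F y = S^p x], and [H] intertwines both powers. The unit translation is
   recovered likewise from [T^u] and [S^q]. *)
have HF y : H (F y) = F' (H y).
  have [x <-] := degree1_surj (degree1_iter w (degree1_power q p dF)) y.
  rewrite (power_bezout_F dF upwq) (iterH _ _ _ _ (fun y => HS y (hullT y))).
  by rewrite -(power_bezout_F dF' upwq) -(iterH _ _ _ _ HT).
have H1 y : H (y + 1) = H y + 1.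
  have [x <-] := degree1_surj (degree1_iter u (degree1_power q p dF)) y.
  rewrite -(power_bezout_1 dF upwq) (iterH _ _ _ _ (fun y => HS y (hullT y))).
  by rewrite (power_bezout_1 dF' upwq) -(iterH _ _ _ _ HT).
have iH : {homo H : a b / a < b} by move=> a b; exact: Hlt.
have /choice[K HK'] : forall y, exists x, H x = y.
  by move=> y; have [x _ xy] := Honto y (hullT' y); exists x.
have KH : cancel H K by apply: inj_can_sym HK' _; apply/inc_inj/le_mono.
have iK : {homo K : a b / a < b}.
  by move=> a b ab; rewrite -(leW_mono (le_mono iH)) !HK'.
exists H; split=> //; split=> //.
(* Continuity comes from order alone: [H] is inverse to an increasing bijection. *)
exact: increasing_can_continuous iK HK' KH.
Qed.

Lemma coded_class k f g F H : lift_of f F -> lift_of g H ->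
  coded k F -> coded k H -> conjugacy_class f = conjugacy_class g.
Proof.
move=> Ff Hg kF kH.
have [K [dK KE]] := coded_conj (lift_of_degree1 Ff) (lift_of_degree1 Hg) kF kH.
have [c [_ Kc]] := homeo_of_degree1 dK.
have cfg : (c * f = g * c)%g.
  apply: homeoS1_ext => x; rewrite -[x]circle_reprK.
  change (fun_of_homeoS1 c (fun_of_homeoS1 f (circle_pi (repr x))) =
    fun_of_homeoS1 g (fun_of_homeoS1 c (circle_pi (repr x)))).
  by case: Ff Hg => _ fE [_ gE]; rewrite -fE -!Kc -gE KE.
have -> : g = (f ^ c^-1)%g by rewrite /conjg invgK mulgA cfg mulgK.
apply/seteqP; split=> _ [h _ <-].
- by exists (c * h)%g => //; rewrite -conjgM mulKg.
- by exists (c^-1 * h)%g => //; rewrite conjgM.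
Qed.

Lemma degree1_iter_fix K n x : degree1 K -> (0 < n)%N ->
  iter n K x = x -> K x = x.
Proof.
move=> dK; case: n => // n _ Kx; have [xK|Kx'|//] := ltgtP x (K x).
- have : x < iter n.+1 K x; last by rewrite Kx ltxx.
  elim: n {Kx} => // n ih; rewrite iterS (lt_trans xK)// degree1_mono//.
- have : iter n.+1 K x < x; last by rewrite Kx ltxx.
  elim: n {Kx} => // n ih; rewrite iterS; apply: lt_trans Kx'.
  by rewrite degree1_mono.
Qed.

Lemma coded_exists q (p : int) f F : lift_of f F ->
  (exists x, root_set q p F x) -> ~ infinitely_many_roots q p F ->
  exists k F', lift_of f F' /\ coded k F'.
Proof.
move=> Ff0 [z rz] fin.
(* Replacing F by F + j makes the numerator positive. *)
pose j : int := `|p| + 1; pose F' x := F x + j%:~R.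
have Ff : lift_of f F' by exact: lift_of_addint.
have dF := lift_of_degree1 Ff0; have dF' := lift_of_degree1 Ff.
have [P PE] : exists P : nat, p + j * q.+1%:Z = P.+1%:Z.
  by exists (absz (p + j * q.+1%:Z)).-1; rewrite /j; nia.
have iterF' n x : iter n F' x = iter n F x + (j * n%:Z)%:~R.
  elim: n => [|n ih] /=; first by rewrite mulr0 addr0.
  rewrite ih /F' degree1_int// -addrA -intrD; congr (_ + _%:~R).
  by rewrite -[in RHS]addn1 PoszD mulrDr mulr1.
have rootE x : root_set q p F x <-> power F' q.+1 P.+1 x = x.
  rewrite /root_set /mkset /power iterF' -[P.+1%:R]/(P.+1%:Z%:~R) -PE intrD.
  by split=> [->|]; lra.
(* Bezout needs coprime numbers. Dividing by [g] keeps the root set: the original power is [T^g],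
   and every periodic point of the increasing map [T] is fixed. *)
pose g := gcdn P.+1 q.+1.
have g0 : (0 < g)%N by rewrite gcdn_gt0.
pose q1 := (q.+1 %/ g)%N; pose p1 := (P.+1 %/ g)%N.
have gq : (g * q1 = q.+1)%N by rewrite mulnC divnK// dvdn_gcdr.
have gp : (g * p1 = P.+1)%N by rewrite mulnC divnK// dvdn_gcdl.
have p10 : (0 < p1)%N by move: gp; case: p1 => //; rewrite muln0.
have g1 : gcdn p1 q1 = 1%N.
  by apply/eqP; rewrite -(eqn_pmul2l g0) muln_gcdr gp gq muln1.
have [u w upwq _] := egcdnP q1 p10; rewrite g1 in upwq.
pose T := power F' q1 p1; have dT : degree1 T := degree1_power q1 p1 dF'.
have fixE x : root_set q p F x <-> T x = x.
  rewrite rootE -gq -gp; have := iter_power q1 p1 g x dF'; rewrite -/T => e.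
  rewrite /power -e; split=> [|Tx]; first exact: degree1_iter_fix.
  by elim: (g) => // n /= ->.
have Tz : T z = z by exact/fixE.
have zc := power_fix_lt dF' upwq Tz; set c := power F' u w z in zc.
have finA : finite_set [set x | z < x <= c /\ T x = x].
  pose m := (maxn (Num.bound `|z|) (Num.bound `|c|)).
  have zm : `|z| < m%:R.
    by rewrite (lt_le_trans (archi_boundP _))// ler_nat leq_maxl.
  have cm : `|c| < m%:R.
    by rewrite (lt_le_trans (archi_boundP _))// ler_nat leq_maxr.
  have : finite_set [set x | - m%:R <= x < m%:R /\ root_set q p F x].
    by apply: contrapT => inf; apply: fin; exists m.
  apply: sub_finite_set => x [/andP[zx xc] Tx]; split; last exact/fixE.
  by move: zm cm; rewrite !ltr_norml => /andP[? ?] /andP[? ?]; apply/andP; lra.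
have [s sE] := (finite_seqP _).1 finA.
pose l := sort <=%R (undup s).
have lE x : x \in l <-> z < x <= c /\ T x = x.
  rewrite mem_sort mem_undup.
  by have <- : [set` s] x = (z < x <= c /\ T x = x) by rewrite -sE.
have pl : path <%R z l.
  rewrite lt_path_sortedE sort_lt_sorted undup_uniq andbT.
  by apply/allP => x /lE[/andP[]].
(* The end [c = S z] of the fundamental domain is fixed by [T] because [T] and [S] commute, so it
   closes the sorted list. *)
have cl : c \in l.
  apply/lE; rewrite zc lexx; split=> //.
  by rewrite /c /T power_comm// -/T Tz.
have lc : last z l = c.
  have ll : last z l \in l by move: cl; case: (l) => // y t _ /=; exact: mem_last.
  have [/andP[_ h1] _] := (lE _).1 ll.
  by apply/le_anti; rewrite h1/= path_le_last// inE cl orbT.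
have [sg gT] : exists sg, gaps T z l sg.
  apply: gaps_exist => //; first by case: dT.
  by move=> x; rewrite lc => /andP[zx xc]; split=> [Tx|/lE[]//]; apply/lE; rewrite zx.
by exists (q1, p1, u, w, sg), F'; split=> //; split=> //; exists z, l.
Qed.

End coded_classes.

(** * Enumeration of the non-Haar null classes by codes *)

Theorem corollary1p9 (R : realType) :
  countable [set C : set (homeoS1 R) |
    (exists f : homeoS1 R, C = conjugacy_class f) /\ ~ haar_null R C].
Proof.
(* By [coded_class] all homeomorphisms with a lift of code [k] share one class, so the choice loses
   nothing; unrealized codes get [set0]. *)
pose class_of (k : code) : set (homeoS1 R) := xget set0
  [set C | exists f F, [/\ lift_of f F, coded k F & C = conjugacy_class f]].
apply: (@sub_countable _ _ _ [set: code]); last exact: countableP.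
apply: card_le_trans (card_image_le class_of setT).
apply: subset_card_le => C [[f ->] not_null].
have [F Ff] := lift_exists f.
have [[q [p rqp]]|no] := pselect (exists q p, exists x, root_set q p F x).
  have fin : ~ infinitely_many_roots q p F.
    by move=> /(haar_null_infinitely_many_roots Ff).
  have [k [F' [Ff' kF']]] := coded_exists Ff rqp fin.
  exists k => //; rewrite /class_of; case: xgetP => [_ -> [g [H [gH kH ->]]]|].
    exact: coded_class gH Ff' kH kF'.
  by move=> /(_ (conjugacy_class f)) []; exists f, F'.
exfalso; apply: not_null; apply: (haar_null_no_periodic Ff) => q p x Fx.
by apply: no; exists q, p, x.
Qed.
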